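(* Let $\beta\in[0,1]$ and consider the Curie–Weiss model with Glauber rates on $\mathcal X=\{0,1\}$, i.e. the non-linear Markov triple with $$K_x(\mu)=\beta\sum_{y\in\{0,1\}}W_{xy}\mu_y,\qquad W_{00}=W_{11}=0,\ W_{01}=W_{10}=1,$$ $$Q(\mu;0,1)=\exp\big(-\beta(\mu_0-\mu_1)\big),\qquad Q(\mu;1,0)=\exp\big(\beta(\mu_0-\mu_1)\big).$$ Then the optimal (largest) constant $\kappa=\kappa_{\mathrm{Glauber}}$ such that $\mathrm{Ric}(\{0,1\},Q,\pi)\ge\kappa$ is $$\kappa_{\mathrm{Glauber}}=2(1-\beta).$$
   Context: $\mathcal X=\{0,1\}$; $\mathcal P(\mathcal X)$ is the set of probability vectors $\mu=(\mu_0,\mu_1)$. Here $U(\mu)=\sum_x\mu_xK_x(\mu)=2\beta\mu_0\mu_1$, $H_x(\mu)=\partial_{\mu_x}U(\mu)$, and $\pi_x(\mu)=Z(\mu)^{-1}\exp(-H_x(\mu))$ is the local Gibbs measure (with $Z(\mu)$ the normalizing constant); $Q(\mu)$, with $Q(\mu;x,x)=-\sum_{y\ne x}Q(\mu;x,y)$, satisfies detailed balance with respect to $\pi(\mu)$, the Glauber rates being $Q(\mu;0,1)=\sqrt{\pi_1(\mu)/\pi_0(\mu)}$ and $Q(\mu;1,0)=\sqrt{\pi_0(\mu)/\pi_1(\mu)}$. Free energy: $\mathcal F(\mu)=\mu_0\log\mu_0+\mu_1\log\mu_1+2\beta\mu_0\mu_1$, with $0\log0=0$. Distance $\mathcal W$: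 let $\Lambda(a,b)=\int_0^1a^{1-s}b^s\,ds$ be the logarithmic mean and $\Lambda(\mu)_{xy}=\Lambda(\mu_xQ(\mu;x,y),\mu_yQ(\mu;y,x))$ for $x\ne y$ (diagonal values are irrelevant). For $\psi\in\mathbb R^{\mathcal X}$ let $\nabla\psi_{xy}=\psi_y-\psi_x$; for $\Psi\in\mathbb R^{\mathcal X\times\mathcal X}$ let $(\nabla\cdot\Psi)_x=\frac12\sum_y(\Psi_{xy}-\Psi_{yx})$; $\cdot$ between matrices is the entrywise product. Action: $\mathcal A(\mu,\psi)=\frac12\sum_{x,y}(\psi_y-\psi_x)^2\Lambda(\mu)_{xy}$. $\mathrm{CE}$ is the set of curves $(\mu_t,\psi_t)_{t\in[0,1]}$ with $t\mapsto\mu_t\in\mathcal P(\mathcal X)$ continuous, $t\mapsto\psi_t\in\mathbb R^{\mathcal X}$ measurable and integrable, satisfying $\dot\mu_t+\nabla\cdot(\Lambda(\mu_t)\cdot\nabla\psi_t)=0$ in the distributional sense. $\mathcal W(\mu_0,\mu_1)=\inf\big(\int_0^1\mathcal A(\mu_t,\psi_t)\,dt\big)^{1/2}$ over $(\mu,\psi)\in\mathrm{CE}$ connecting the two given measures. A $\mathcal W$-geodesic is a curve $(\mu_t)_{t\in[0,1]}$ with $\mathcal W(\mu_s,\mu_t)=|s-t|\mathcal W(\mu_{t=0},\mu_{t=1})$. Curvature: $\mathrm{Ric}(\mathcal X,Q,\pi)\ge\kappa$ means that for every $\mathcal W$-geodesic $(\mu_t)_{t\in[0,1]}$ and all $t\in[0,1]$,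 $\mathcal F(\mu_t)\le(1-t)\mathcal F(\mu_{t=0})+t\mathcal F(\mu_{t=1})-\frac\kappa2t(1-t)\mathcal W(\mu_{t=0},\mu_{t=1})^2$. *)

(* Defs.v *)
From HB Require Import structures.
From mathcomp Require Import all_boot all_order all_algebra.
From mathcomp Require Import all_classical all_reals all_analysis.
From mathcomp Require Import ring.

Set Implicit Arguments.
Unset Strict Implicit.
Unset Printing Implicit Defensive.

Import Order.TTheory GRing.Theory Num.Theory.
Import numFieldNormedType.Exports.

Local Open Scope classical_set_scope.
Local Open Scope ring_scope.

(* The state space is 'I_n; measures and functions on it are row vectors. *)

Definition is_prob (R : realType) (n : nat) (mu : 'rV[R]_n) : Prop :=
  (forall x, 0 <= mu 0 x) /\ \sum_x mu 0 x = 1.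

Definition potential_energy (R : realType) (n : nat)
    (K : 'I_n -> 'rV[R]_n -> R) (mu : 'rV[R]_n) : R :=
  \sum_x mu 0 x * K x mu.

(* H_x(mu): the partial derivative of U with respect to the coordinate mu_x,
   with U regarded as a function on the whole of R^n. *)
Definition hamiltonian (R : realType) (n : nat)
    (K : 'I_n -> 'rV[R]_n -> R) (x : 'I_n) (mu : 'rV[R]_n) : R :=
  'D_(delta_mx 0 x) (potential_energy K) mu.

Definition gibbs (R : realType) (n : nat)
    (K : 'I_n -> 'rV[R]_n -> R) (mu : 'rV[R]_n) (x : 'I_n) : R :=
  (\sum_y expR (- hamiltonian K y mu))^-1 * expR (- hamiltonian K x mu).

(* The triple ('I_n, Q, pi); pi is the family [gibbs K]. *)
Record markov_triple (R : realType) (n : nat) := MarkovTriple {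
  mt_K : 'I_n -> 'rV[R]_n -> R;
  mt_Q : 'rV[R]_n -> 'M[R]_n;
  mt_Q_ge0 : forall mu x y, is_prob mu -> x != y -> 0 <= mt_Q mu x y;
  mt_Q_diag : forall mu x, is_prob mu ->
    mt_Q mu x x = - \sum_(y | y != x) mt_Q mu x y;
  mt_detailed_balance : forall mu x y, is_prob mu ->
    gibbs mt_K mu x * mt_Q mu x y = gibbs mt_K mu y * mt_Q mu y x }.

(* [ln 0 = 0], hence 0 log 0 = 0. *)
Definition free_energy (R : realType) (n : nat) (T : markov_triple R n)
    (mu : 'rV[R]_n) : R :=
  \sum_x mu 0 x * ln (mu 0 x) + potential_energy (mt_K T) mu.

Definition log_mean (R : realType) (a b : R) : R :=
  \int[lebesgue_measure]_(s in `[0%R, 1%R]) (a `^ (1 - s) * b `^ s).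

(* The diagonal only ever multiplies psi_x - psi_x = 0; it is set to 0. *)
Definition Lambda (R : realType) (n : nat) (T : markov_triple R n)
    (mu : 'rV[R]_n) : 'M[R]_n :=
  \matrix_(x, y) if x == y then 0
    else log_mean (mu 0 x * mt_Q T mu x y) (mu 0 y * mt_Q T mu y x).

Definition dgrad (R : realType) (n : nat) (psi : 'rV[R]_n) : 'M[R]_n :=
  \matrix_(x, y) (psi 0 y - psi 0 x).

Definition ddiv (R : realType) (n : nat) (Psi : 'M[R]_n) : 'rV[R]_n :=
  \row_x (2^-1 * \sum_y (Psi x y - Psi y x)).

Definition action (R : realType) (n : nat) (T : markov_triple R n)
    (mu psi : 'rV[R]_n) : R :=
  2^-1 * \sum_x \sum_y (psi 0 y - psi 0 x) ^+ 2 * Lambda T mu x y.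

(* C_c^oo(]0, 1[); the support, being closed and contained in ]0, 1[, is
   automatically compact. *)
Definition test_function (R : realType) (phi : R -> R) : Prop :=
  (forall k t, derivable (derive1n k phi) t 1) /\
  closure [set t | phi t != 0] `<=` `]0, 1[.

Definition continuity_equation (R : realType) (n : nat) (T : markov_triple R n)
    (mu psi : R -> 'rV[R]_n) : Prop :=
  forall (phi : R -> R) (x : 'I_n), test_function phi ->
    - (\int[lebesgue_measure]_(t in `[0%R, 1%R]) (derive1 phi t * mu t 0 x))
    + (\int[lebesgue_measure]_(t in `[0%R, 1%R])
        (phi t * ddiv (map2_mx *%R (Lambda T (mu t)) (dgrad (psi t))) 0 x)) = 0.

(* Curves are total functions on R of which only the restriction to [0, 1]
   matters. *)
Definition CE (R : realType) (n : nat) (T : markov_triple R n)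
    (mu psi : R -> 'rV[R]_n) : Prop :=
  [/\ forall t, t \in `[0, 1] -> is_prob (mu t),
      forall x, {within `[0, 1], continuous (fun t => mu t 0 x)},
      forall x, lebesgue_measure.-integrable `[0, 1]
                  (fun t => (psi t 0 x)%:E)
    & continuity_equation T mu psi].

Definition W_dist (R : realType) (n : nat) (T : markov_triple R n)
    (nu0 nu1 : 'rV[R]_n) : \bar R :=
  ereal_inf [set w | exists mu psi : R -> 'rV[R]_n,
    [/\ CE T mu psi, mu 0 = nu0, mu 1 = nu1
      & w = sqrte (\int[lebesgue_measure]_(t in `[0%R, 1%R])
                     (action T (mu t) (psi t))%:E)%E]].

Definition geodesic (R : realType) (n : nat) (T : markov_triple R n)
    (mu : R -> 'rV[R]_n) : Prop :=
  (forall t, t \in `[0, 1] -> is_prob (mu t)) /\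
  (forall s t, s \in `[0, 1] -> t \in `[0, 1] ->
     W_dist T (mu s) (mu t) = (`|s - t|%:E * W_dist T (mu 0%R) (mu 1%R))%E).

Definition Ric_ge (R : realType) (n : nat) (T : markov_triple R n)
    (kappa : R) : Prop :=
  forall mu : R -> 'rV[R]_n, geodesic T mu ->
  forall t : R, t \in `[0, 1] ->
    ((free_energy T (mu t))%:E <=
      ((1 - t) * free_energy T (mu 0%R) + t * free_energy T (mu 1%R))%:E
      - (kappa / 2 * t * (1 - t))%:E * W_dist T (mu 0%R) (mu 1%R) ^+ 2)%E.

Definition cw_W (R : realType) : 'M[R]_2 :=
  \matrix_(x, y) if x == y then 0 else 1.

Definition cw_K (R : realType) (beta : R) (x : 'I_2) (mu : 'rV[R]_2) : R :=
  beta * \sum_y cw_W R x y * mu 0 y.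

(* Rate of the jump from x to the other state. *)
Definition glauber_rate (R : realType) (beta : R) (mu : 'rV[R]_2)
    (x : 'I_2) : R :=
  if x == 0 then expR (- (beta * (mu 0 0 - mu 0 1)))
  else expR (beta * (mu 0 0 - mu 0 1)).

Definition cw_Q (R : realType) (beta : R) (mu : 'rV[R]_2) : 'M[R]_2 :=
  \matrix_(x, y) if x == y then - glauber_rate beta mu x
                 else glauber_rate beta mu x.

Lemma cw_Q_ge0 (R : realType) (beta : R) (mu : 'rV[R]_2) (x y : 'I_2) :
  is_prob mu -> x != y -> 0 <= cw_Q beta mu x y.
Proof.
move=> _ /negbTE xy; rewrite mxE xy /glauber_rate.
by case: ifP => _; rewrite expR_ge0.
Qed.

Lemma cw_Q_diag (R : realType) (beta : R) (mu : 'rV[R]_2) (x : 'I_2) :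
  is_prob mu -> cw_Q beta mu x x = - \sum_(y | y != x) cw_Q beta mu x y.
Proof.
move=> _; rewrite big_mkcond big_ord_recl big_ord1.
by case: x => [[|[|//]] i]; rewrite !mxE /= ?addr0 ?add0r.
Qed.

Lemma cw_potential_energyE (R : realType) (beta : R) (mu : 'rV[R]_2) :
  potential_energy (cw_K beta) mu = 2 * beta * mu 0 0 * mu 0 1.
Proof.
rewrite /potential_energy /cw_K !big_ord_recl !big_ord0 !mxE /=.
have -> : lift ord0 ord0 = 1 :> 'I_2 by apply/val_inj.
rewrite -[ord0]/(0 : 'I_2); ring.
Qed.

Lemma cw_hamiltonianE (R : realType) (beta : R) (x : 'I_2) (mu : 'rV[R]_2) :
  hamiltonian (cw_K beta) x mu =
  2 * beta * (if x == 0 then mu 0 1 else mu 0 0).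
Proof.
rewrite /hamiltonian /derive; apply: cvg_lim => //.
apply: cvg_near_cst; near=> h.
have h0 : h != 0 by near: h; exact: nbhs_dnbhs_neq.
rewrite /= !cw_potential_energyE !mxE /GRing.scale /=.
by case: x => [[|[|//]] i] /=; field.
Unshelve. all: by end_near. Qed.

Lemma cw_detailed_balance (R : realType) (beta : R) (mu : 'rV[R]_2)
    (x y : 'I_2) : is_prob mu ->
  gibbs (cw_K beta) mu x * cw_Q beta mu x y =
  gibbs (cw_K beta) mu y * cw_Q beta mu y x.
Proof.
move=> _; have [->//|xy] := eqVneq x y.
rewrite /gibbs !cw_hamiltonianE.
move: (\sum_(_ < _) _)^-1 => z; rewrite -2!(mulrA z); congr (z * _).
rewrite [cw_Q _ _ _ _]mxE [in RHS]mxE [y == x]eq_sym (negbTE xy).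
case: x y xy => [[|[|//]] i] [[|[|//]] j] // _;
  rewrite /glauber_rate /= -!expRD; congr expR; ring.
Qed.

Lemma cw_Q_glauber (R : realType) (beta : R) (mu : 'rV[R]_2) (x y : 'I_2) :
  x != y ->
  cw_Q beta mu x y =
  Num.sqrt (gibbs (cw_K beta) mu y / gibbs (cw_K beta) mu x).
Proof.
move=> xy; rewrite mxE (negbTE xy) -[LHS]gtr0_norm; last first.
  by rewrite /glauber_rate; case: ifP => _; rewrite expR_gt0.
rewrite -sqrtr_sqr; congr Num.sqrt.
rewrite /gibbs !cw_hamiltonianE.
have Z_neq0 (f : 'I_2 -> R) : \sum_y expR (f y) != 0.
  rewrite !big_ord_recl big_ord0 addr0.
  by apply: lt0r_neq0; apply: addr_gt0; exact: expR_gt0.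
move: (Z_neq0 (fun y => - hamiltonian (cw_K beta) y mu)).
move: (\sum_(_ < _) _) => z z0.
rewrite invfM invrK mulrACA mulVf// mul1r -expRN -expRD expr2.
case: x y xy => [[|[|//]] i] [[|[|//]] j] // _;
  rewrite /glauber_rate /= -expRD; congr expR; ring.
Qed.

Definition curie_weiss (R : realType) (beta : R) : markov_triple R 2 :=
  MarkovTriple (@cw_Q_ge0 R beta) (@cw_Q_diag R beta)
    (@cw_detailed_balance R beta).

(* Main.v *)
Require Import Defs.
From mathcomp Require Import all_boot all_order all_algebra.
From mathcomp Require Import all_classical all_reals all_analysis.
From mathcomp Require Import measurable_realfun ring lra.

(** A probability vector on two states is determined by its magnetization
    m = mu_0 - mu_1 in [-1, 1], so the transport geometry is one-dimensional.
    Write a and b for the two opposite Glauber flows, theta(m) for their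
    logarithmic mean (the mobility) and v = psi_1 - psi_0.  The continuity
    equation becomes m' = - 2 theta(m) v and the action becomes
    theta(m) v^2 = m'^2 / (4 theta(m)).  Therefore W is the distance of the
    line element dS = dm / (2 sqrt theta(m)): W(x, y) = |S y - S x|
    ([W_dist_arclength]), and geodesics are the curves along which S is affine.

    Let F be the free energy as a function of m.  Then ln a - ln b = 2 F', so
    theta = (a - b) / (2 F'), and differentiating twice along arc length gives
      dF/dS = 2 sqrt theta F',   d^2F/dS^2 = (a - b)' + 2 theta F''.
    The first term is at least 1 - beta.  For the second, the logarithmic mean
    dominates the geometric mean, so 2 theta >= sqrt (1 - m^2), while
    F'' = 1 / (1 - m^2) - beta; the product is at least 1 - beta.  Hence F is
    2 (1 - beta)-convex along geodesics ([entropy_tangent]).  Both bounds are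
    sharp as m tends to 0, and short geodesics centred at 0 show that no larger
    constant works ([Ric_le_of_small]).

    Two points need real analysis.  The lower bound on W has to hold for every
    integrable psi and a continuity equation that holds only in the sense of
    distributions: testing it with smooth steps bounds the increments of m by
    the integral of 2 theta |v| ([weak_derivative_increment]), and these local
    bounds are chained along the curve, with no chain rule for absolutely
    continuous functions ([curve_length_ge]).  The mobility vanishes at m = -1
    and m = 1, so explicit minimizing curves are built between interior points
    only.  A geodesic of positive length meets each boundary point at most
    once ([geodesic_boundary_times]), so every inequality about it follows by
    continuity from interior times ([geodesic_convex]). *)

Set Implicit Arguments.
Unset Strict Implicit.
Unset Printing Implicit Defensive.
Import Order.TTheory GRing.Theory Num.Theory.
Import numFieldNormedType.Exports.
Local Open Scope classical_set_scope.
Local Open Scope ring_scope.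

(** * Calculus on the line *)

Section calculus.
Context {R : realType}.
Implicit Types (f F : R -> R) (a b m x y : R).
Notation mu := (@lebesgue_measure R).

Lemma is_derive_continuous f x d : is_derive x 1 f d -> {for x, continuous f}.
Proof. by move=> [fx _]; exact/differentiable_continuous/derivable1_diffP. Qed.

Lemma continuous_itv_integrable f a b : {within `[a, b], continuous f} ->
  mu.-integrable `[a, b] (EFin \o f).
Proof. by move=> cf; apply: continuous_compact_integrable => //; exact: segment_compact. Qed.

(** The derivative is taken in the open interval only, so the lemma applies on
    either side of a point at which no derivative is known. *)
Lemma nondecreasing_is_derive f (df : R -> R) a b : a <= b ->
  (forall x, a < x < b -> is_derive x 1 f (df x)) ->
  (forall x, a <= x <= b -> {for x, continuous f}) ->
  (forall x, a < x < b -> 0 <= df x) -> f a <= f b.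
Proof.
move=> ab fd fc df0.
move: ab; rewrite le_eqVlt => /predU1P[->//|ab].
have cf : {within `[a, b], continuous f}.
  apply: continuous_in_subspaceT => x.
  by rewrite inE /= in_itv /=; exact: fc.
have dfab x : x \in `]a, b[ -> is_derive x 1 f (df x) by rewrite in_itv /=; exact: fd.
have [c cab E] := MVT ab dfab cf.
rewrite -subr_ge0 E mulr_ge0 ?subr_ge0 ?(ltW ab)//.
by apply: df0; rewrite in_itv /= in cab.
Qed.

Lemma Rintegral_is_derive_itv f F a b : a <= b ->
  {within `[a, b], continuous f} ->
  (forall x, a <= x <= b -> is_derive x 1 F (f x)) ->
  \int[mu]_(x in `[a, b]) f x = F b - F a.
Proof.
rewrite le_eqVlt => /predU1P[->|ab] cf dF.
  by rewrite set_itv1 Rintegral_set1 subrr.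
have dFa : is_derive a 1 F (f a) by apply: dF; rewrite lexx ltW.
have dFb : is_derive b 1 F (f b) by apply: dF; rewrite lexx ltW.
have dFx x : x \in `]a, b[ -> is_derive x 1 F (f x).
  by rewrite in_itv /= => /andP[ax xb]; apply: dF; rewrite !ltW.
rewrite /Rintegral (@continuous_FTC2 R f F a b ab) //.
- split; first by move=> x /dFx [].
  + by apply: cvg_at_right_filter; exact: is_derive_continuous dFa.
  + by apply: cvg_at_left_filter; exact: is_derive_continuous dFb.
- by move=> x /dFx; rewrite derive1E => -[].
Qed.

Lemma Rintegral_is_derive f F a b : a <= b -> continuous f ->
  (forall x, is_derive x 1 F (f x)) ->
  \int[mu]_(x in `[a, b]) f x = F b - F a.
Proof.
by move=> ab cf dF; apply: Rintegral_is_derive_itv => //; exact: continuous_subspaceT.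
Qed.

Lemma is_derive_ln_comp f x df : 0 < f x -> is_derive x 1 f df ->
  is_derive x 1 (fun y => ln (f y)) (df / f x).
Proof. by move=> fx0 fd; rewrite mulrC; exact: is_derive1_comp (is_derive1_ln fx0) fd. Qed.

Lemma is_derive_sqrt_comp f x df : 0 < f x -> is_derive x 1 f df ->
  is_derive x 1 (fun y => Num.sqrt (f y)) (df / (2 * Num.sqrt (f x))).
Proof. by move=> fx0 fd; rewrite mulrC; exact: is_derive1_comp (is_derive1_sqrt fx0) fd. Qed.

Lemma itvNcc_cases m : -1 <= m <= 1 -> [\/ m = -1, m = 1 | -1 < m < 1].
Proof.
move=> /andP[]; rewrite le_eqVlt => /predU1P[<- _|h1]; first by constructor 1.
rewrite le_eqVlt => /predU1P[<-|h2]; first by constructor 2.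
by constructor 3; rewrite h1.
Qed.

Lemma onem_sqr_gt0 m : -1 < m < 1 -> 0 < 1 - m ^+ 2.
Proof. by move=> /andP[? ?]; nra. Qed.

Lemma mulr_expR_subN_ge0 y : 0 <= y * (expR y - expR (- y)).
Proof.
have [y0|y0] := leP 0 y.
  by rewrite mulr_ge0// subr_ge0 ler_expR; lra.
rewrite -mulrNN mulr_ge0 ?oppr_ge0 ?(ltW y0)// subr_le0 ler_expR; lra.
Qed.

Lemma near_itvN11 m : -1 < m < 1 -> \near m, -1 < m < 1.
Proof.
move=> /andP[h1 h2]; near=> x; apply/andP; split; near: x.
  exact: lt_nbhsr.
exact: lt_nbhsl.
Unshelve. all: by end_near. Qed.

(** At 0, the bound -ln y = 2 ln (1 / sqrt y) <= 2 / sqrt y gives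
    |y ln y| <= 2 sqrt y for 0 < y < 1, and [ln] vanishes on the nonpositive
    reals. *)
Lemma xlnx_continuous : continuous (fun x => x * ln x).
Proof.
move=> x; have [x0|x0|x0] := ltgtP x 0.
- have E : x * ln x = 0 by rewrite ln0 ?mulr0// ltW.
  rewrite /continuous_at E; apply: cvg_near_cst.
  by near=> y; rewrite ln0 ?mulr0// ltW//; near: y; exact: lt_nbhsl.
- by apply: continuousM => //; exact: continuous_ln.
rewrite x0 /continuous_at mul0r; apply: norm_cvg0.
apply: (@squeeze_cvgr _ (nbhs (0 : R)) _ R (cst 0) (fun y => 2 * Num.sqrt `|y|)).
- near=> y; rewrite normr_ge0 /=.
  have [y0|y0] := leP y 0; first by rewrite ln0// mulr0 normr0 mulr_ge0// sqrtr_ge0.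
  have y1 : y < 1 by near: y; exact: lt_nbhsl.
  have s0 : 0 < Num.sqrt y by rewrite sqrtr_gt0.
  rewrite (gtr0_norm y0) normrM (gtr0_norm y0) ler0_norm ?ln_le0 ?(ltW y1)//.
  have yE : y = Num.sqrt y ^+ 2 by rewrite sqr_sqrtr// ltW.
  have lnE : - ln y = 2 * ln (Num.sqrt y)^-1.
    by rewrite lnV ?posrE// {1}yE lnXn// mulrN mulr_natl.
  have h : ln (Num.sqrt y)^-1 <= (Num.sqrt y)^-1.
    by rewrite ltW// ln_sublinear// invr_gt0.
  rewrite lnE {1}yE.
  have -> : 2 * Num.sqrt y = Num.sqrt y ^+ 2 * (2 * (Num.sqrt y)^-1).
    by field; rewrite gt_eqF.
  by rewrite ler_wpM2l ?sqr_ge0// ler_wpM2l.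
- exact: cvg_cst.
- suff : 2 * Num.sqrt `|y| @[y --> (0 : R)] --> 2 * Num.sqrt `|0 : R|.
    by rewrite normr0 sqrtr0 mulr0.
  apply: cvgM; first exact: cvg_cst.
  apply: (@continuous_comp _ _ _ (fun y : R => `|y|) Num.sqrt).
    exact: norm_continuous.
  exact: sqrt_continuous.
Unshelve. all: by end_near. Qed.

(** Lets finitely many exceptional times be avoided: a function that does not
    take its limit value near 0 takes no other given value there either. *)
Lemma near0_right_neq (f : R -> R) (a b : R) : f e @[e --> 0^'+] --> b ->
  (\forall e \near 0^'+, f e != b) -> \forall e \near 0^'+, f e != a.
Proof.
move=> cf f0; have [->//|] := eqVneq a b.
rewrite neq_lt => /orP[ab|ba].
  have H := cvgr_gt _ cf _ ab.
  by near=> e; rewrite gt_eqF//; near: e; exact: H.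
have H := cvgr_lt _ cf _ ba.
by near=> e; rewrite lt_eqF//; near: e; exact: H.
Unshelve. all: by end_near.
Qed.

(** Equality in the triangle inequality on a line forces the middle point to be
    the barycentre; multiplied out so that no distance has to be nonzero. *)
Lemma collinear_distances (a b d p q : R) : 0 <= p -> 0 <= q ->
  `|b - a| = p -> `|d - b| = q -> `|d - a| = p + q ->
  (p + q) * b = q * a + p * d.
Proof.
move=> p0 q0.
have [h1|h1] := ger0P (b - a); have [h2|h2] := ger0P (d - b);
  have [h3|h3] := ger0P (d - a) => e1 e2 e3.
- by rewrite -e1 -e2; ring.
all: try by exfalso; lra.
all: first [by rewrite -e1 -e2; ring
  | by have -> : b = a by [lra]; have -> : p = 0 by [lra]; ring
  | by have -> : b = d by [lra]; have -> : q = 0 by [lra]; ring].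
Qed.

End calculus.

(** * The logarithmic mean *)

Section log_mean_theory.
Context {R : realType}.
Implicit Types a b : R.
Notation mu := (@lebesgue_measure R).

Let expi (c d s : R) := expR ((1 - s) * c + s * d).

Let expi_der (c d x : R) : is_derive x 1 (expi c d) ((d - c) * expi c d x).
Proof. by rewrite /expi; apply: is_derive_eq; rewrite /GRing.scale /=; ring. Qed.

Let expi_cont (c d : R) : continuous (expi c d).
Proof. by move=> x; exact: is_derive_continuous (expi_der c d x). Qed.

Let expi_int (c d : R) : mu.-integrable `[0, 1] (EFin \o expi c d).
Proof. by apply: continuous_itv_integrable; exact: continuous_subspaceT. Qed.

Let log_meanE a b : 0 < a -> 0 < b ->
  log_mean a b = \int[mu]_(s in `[0, 1]) expi (ln a) (ln b) s.
Proof.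
move=> a0 b0; apply: eq_Rintegral => s _.
by rewrite -{1}[a]lnK ?posrE// -{1}[b]lnK ?posrE// -!expRM -expRD /expi !(mulrC (ln _)).
Qed.

(** The integrand b^s a^(1 - s) is an exponential in s with rate ln b - ln a. *)
Lemma log_mean_mul a b : 0 < a -> 0 < b ->
  log_mean a b * (ln a - ln b) = a - b.
Proof.
move=> a0 b0; rewrite log_meanE// -RintegralZr//.
pose F (s : R) := - expi (ln a) (ln b) s.
have dF (x : R) : is_derive x 1 F (expi (ln a) (ln b) x * (ln a - ln b)).
  by rewrite /F /expi; apply: is_derive_eq; rewrite /GRing.scale /=; ring.
have cf : continuous (fun s => expi (ln a) (ln b) s * (ln a - ln b)).
  by move=> x; apply: cvgM; [exact: expi_cont | exact: cvg_cst].
rewrite (Rintegral_is_derive ler01 cf dF) /F /expi.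
by rewrite subrr subr0 !mul0r !mul1r add0r addr0 !lnK ?posrE//; ring.
Qed.

(** The tangent line of the exponential at the midpoint s = 1/2 lies below it
    and integrates to the geometric mean. *)
Lemma log_mean_ge_geometric a b : 0 < a -> 0 < b ->
  expR ((ln a + ln b) / 2) <= log_mean a b.
Proof.
move=> a0 b0; rewrite log_meanE//; set c := ln a; set d := ln b.
pose E := expR ((c + d) / 2).
(* tangent line at s = 1/2, with primitive G *)
pose g (s : R) := E * (1 + (s - 2^-1) * (d - c)).
pose G (s : R) := E * (s + 2^-1 * (s * s - s) * (d - c)).
have dg (x : R) : is_derive x 1 g (E * (d - c)).
  by apply: is_derive_eq; rewrite /GRing.scale /=; ring.
have dG (x : R) : is_derive x 1 G (g x).
  by apply: is_derive_eq; rewrite /GRing.scale /= /g; field.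
have cg : continuous g by move=> x; exact: is_derive_continuous (dg x).
have -> : expR ((c + d) / 2) = \int[mu]_(s in `[0, 1]) g s.
  by rewrite (Rintegral_is_derive ler01 cg dG)// /G -/E; field.
apply: le_Rintegral => //.
  by apply: continuous_itv_integrable; exact: continuous_subspaceT.
move=> s _; rewrite /expi /g.
have -> : (1 - s) * c + s * d = (c + d) / 2 + (s - 2^-1) * (d - c) by field.
by rewrite expRD ler_wpM2l ?expR_ge0 ?expR_ge1Dx.
Qed.

(** By convexity the exponential lies below its chord, which integrates to the
    arithmetic mean. *)
Lemma log_mean_le_arithmetic a b : 0 < a -> 0 < b ->
  log_mean a b <= (a + b) / 2.
Proof.
move=> a0 b0; rewrite log_meanE//; set c := ln a; set d := ln b.
pose g (s : R) := (1 - s) * a + s * b.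
pose G (s : R) := a * s + 2^-1 * (s * s) * (b - a).
have dg (x : R) : is_derive x 1 g (b - a).
  by apply: is_derive_eq; rewrite /GRing.scale /=; ring.
have dG (x : R) : is_derive x 1 G (g x).
  by apply: is_derive_eq; rewrite /GRing.scale /= /g; field.
have cg : continuous g by move=> x; exact: is_derive_continuous (dg x).
have -> : (a + b) / 2 = \int[mu]_(s in `[0, 1]) g s.
  by rewrite (Rintegral_is_derive ler01 cg dG)// /G; field.
apply: le_Rintegral => //.
  by apply: continuous_itv_integrable; exact: continuous_subspaceT.
move=> s; rewrite /= in_itv /= => /andP[s0 s1]; rewrite /expi /g.
set u := (1 - s) * c + s * d.
have ha : expR u * (1 + (c - u)) <= a.
  have -> : a = expR u * expR (c - u) by rewrite -expRD addrC subrK lnK ?posrE.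
  by rewrite ler_wpM2l ?expR_ge0 ?expR_ge1Dx.
have hb : expR u * (1 + (d - u)) <= b.
  have -> : b = expR u * expR (d - u) by rewrite -expRD addrC subrK lnK ?posrE.
  by rewrite ler_wpM2l ?expR_ge0 ?expR_ge1Dx.
have s1' : 0 <= 1 - s by rewrite subr_ge0.
apply: le_trans (lerD (ler_wpM2l s1' ha) (ler_wpM2l s0 hb)).
by rewrite le_eqVlt; apply/orP; left; apply/eqP; rewrite /u; ring.
Qed.

Lemma log_mean0l b : log_mean 0 b = 0.
Proof.
rewrite /log_mean -(@Rintegral_itv_bndo_bndc R _ _ (fun s => 0 `^ (1 - s) * b `^ s)).
  rewrite (@eq_Rintegral _ _ _ _ _ (cst 0)); last first.
    move=> s; rewrite inE /= in_itv /= => /andP[_ s1].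
    by rewrite powR0 ?mul0r// subr_eq0 gt_eqF.
  by rewrite Rintegral_cst// mul0r.
apply: (@eq_integrable _ _ _ _ _ _ (EFin \o cst 0)) => //.
- move=> s; rewrite inE /= in_itv /= => /andP[_ s1].
  by rewrite powR0 ?mul0r// subr_eq0 gt_eqF.
- exact: integrable0.
Qed.

Lemma log_mean0r a : log_mean a 0 = 0.
Proof.
rewrite /log_mean -(@Rintegral_itv_obnd_cbnd R _ _ (fun s => a `^ (1 - s) * 0 `^ s)).
  rewrite (@eq_Rintegral _ _ _ _ _ (cst 0)); last first.
    move=> s; rewrite inE /= in_itv /= => /andP[s1 _].
    by rewrite powR0 ?mulr0// gt_eqF.
  by rewrite Rintegral_cst// mul0r.
apply: (@eq_integrable _ _ _ _ _ _ (EFin \o cst 0)) => //.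
- move=> s; rewrite inE /= in_itv /= => /andP[s1 _].
  by rewrite powR0 ?mulr0// gt_eqF.
- exact: integrable0.
Qed.

Lemma log_meanC a b : 0 <= a -> 0 <= b -> log_mean a b = log_mean b a.
Proof.
rewrite le_eqVlt => /predU1P[<- _|a0]; first by rewrite log_mean0l log_mean0r.
rewrite le_eqVlt => /predU1P[<-|b0]; first by rewrite log_mean0l log_mean0r.
have [E|ab] := eqVneq (ln a) (ln b).
  by rewrite (ln_inj _ _ E).
apply: (@mulIf _ (ln a - ln b)); first by rewrite subr_eq0.
by rewrite log_mean_mul// -[ln a - ln b]opprB mulrN log_mean_mul// opprB.
Qed.

End log_mean_theory.

(** * Mobility and free energy as functions of the magnetization *)

Section curie_weiss_functions.
Context {R : realType} (beta : R).
Hypotheses (beta_ge0 : 0 <= beta) (beta_le1 : beta <= 1).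
Implicit Types m x y : R.

(** The flows mu_x Q(mu; x, y) between the two states, in terms of the
    magnetization. *)
Definition flow_up m : R := (1 + m) / 2 * expR (- (beta * m)).
Definition flow_down m : R := (1 - m) / 2 * expR (beta * m).
Definition mobility m : R := log_mean (flow_up m) (flow_down m).
Definition entropy m : R :=
  (1 + m) / 2 * ln ((1 + m) / 2) + (1 - m) / 2 * ln ((1 - m) / 2)
  + 2 * beta * ((1 + m) / 2) * ((1 - m) / 2).
Definition entropy1 m : R := (ln (1 + m) - ln (1 - m)) / 2 - beta * m.
Definition entropy2 m : R := (1 - m ^+ 2)^-1 - beta.

Lemma flow_up_gt0 m : -1 < m < 1 -> 0 < flow_up m.
Proof. by move=> /andP[? ?]; rewrite mulr_gt0 ?expR_gt0//; lra. Qed.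

Lemma flow_down_gt0 m : -1 < m < 1 -> 0 < flow_down m.
Proof. by move=> /andP[? ?]; rewrite mulr_gt0 ?expR_gt0//; lra. Qed.

Lemma flow_up_ge0 m : -1 <= m <= 1 -> 0 <= flow_up m.
Proof. by move=> /andP[? ?]; rewrite mulr_ge0 ?expR_ge0//; lra. Qed.

Lemma flow_down_ge0 m : -1 <= m <= 1 -> 0 <= flow_down m.
Proof. by move=> /andP[? ?]; rewrite mulr_ge0 ?expR_ge0//; lra. Qed.

Lemma ln_flow_up m : -1 < m < 1 -> ln (flow_up m) = ln (1 + m) - ln 2 - beta * m.
Proof.
move=> /andP[? ?]; have ? : 0 < 1 + m by lra.
by rewrite lnM ?posrE ?expR_gt0 ?divr_gt0// ln_div ?posrE// expRK.
Qed.

Lemma ln_flow_down m : -1 < m < 1 -> ln (flow_down m) = ln (1 - m) - ln 2 + beta * m.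
Proof.
move=> /andP[? ?]; have ? : 0 < 1 - m by lra.
by rewrite lnM ?posrE ?expR_gt0 ?divr_gt0// ln_div ?posrE// expRK.
Qed.

(** ln a - ln b is twice the derivative of the free energy: the gradient-flow
    structure of the dynamics, in the form used throughout. *)
Lemma mobility_entropy1 m : -1 < m < 1 ->
  mobility m * (2 * entropy1 m) = flow_up m - flow_down m.
Proof.
move=> m1; rewrite -log_mean_mul ?flow_up_gt0 ?flow_down_gt0//.
by rewrite ln_flow_up// ln_flow_down// /mobility /entropy1; field.
Qed.

Lemma mobility_ge_sqrt m : -1 < m < 1 ->
  Num.sqrt (1 - m ^+ 2) / 2 <= mobility m.
Proof.
move=> m1; have /andP[? ?] := m1.
have h1 : 0 < 1 + m by lra.
have h2 : 0 < 1 - m by lra.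
apply: le_trans (log_mean_ge_geometric (flow_up_gt0 m1) (flow_down_gt0 m1)).
rewrite ln_flow_up// ln_flow_down// le_eqVlt; apply/orP; left; apply/eqP.
have -> : (ln (1 + m) - ln 2 - beta * m + (ln (1 - m) - ln 2 + beta * m)) / 2 =
  (ln (1 + m) + ln (1 - m)) / 2 - ln 2 by field.
rewrite expRB lnK ?posrE//; congr (_ / _).
rewrite -[RHS]ger0_norm ?expR_ge0// -sqrtr_sqr; congr Num.sqrt.
rewrite [RHS]expr2 -expRD -splitr expRD !lnK ?posrE//; ring.
Qed.

Lemma mobility_gt0 m : -1 < m < 1 -> 0 < mobility m.
Proof.
move=> m1; apply: lt_le_trans (mobility_ge_sqrt m1).
by rewrite divr_gt0// sqrtr_gt0 onem_sqr_gt0.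
Qed.

Lemma mobilityN1 : mobility (-1) = 0.
Proof. by rewrite /mobility /flow_up subrr mul0r mul0r log_mean0l. Qed.

Lemma mobility1 : mobility 1 = 0.
Proof. by rewrite /mobility /flow_down subrr mul0r mul0r log_mean0r. Qed.

Lemma mobility_ge0 m : -1 <= m <= 1 -> 0 <= mobility m.
Proof.
by case/itvNcc_cases => [->|->|/mobility_gt0/ltW//]; rewrite ?mobilityN1 ?mobility1.
Qed.

(** With y = beta m, the sum of the flows is half of
    (1 + y) e^-y + (1 - y) e^y - (m - y) (e^y - e^-y).  The first two terms are
    at most 1 each, and the last product is nonnegative because |y| <= |m| and
    y, m have the same sign (this is where 0 <= beta <= 1 enters). *)
Lemma flow_sum_le1 m : -1 <= m <= 1 -> flow_up m + flow_down m <= 1.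
Proof.
move=> /andP[m1 m2]; rewrite /flow_up /flow_down; set y := beta * m.
have h1 : (1 + y) * expR (- y) <= 1.
  by rewrite expRN ler_pdivrMr ?expR_gt0// mul1r expR_ge1Dx.
have h2 : (1 - y) * expR y <= 1.
  by rewrite -[y in expR y]opprK expRN ler_pdivrMr ?expR_gt0// mul1r expR_ge1Dx.
have h3 : 0 <= (m - y) * (expR y - expR (- y)).
  have [m0|m0] := leP 0 m.
    have y0 : 0 <= y by rewrite mulr_ge0.
    by rewrite mulr_ge0// subr_ge0 ?ler_expR; [rewrite /y ler_piMl | lra].
  have y0 : y <= 0 by rewrite mulr_ge0_le0// ltW.
  rewrite -mulrNN mulr_ge0// oppr_ge0 subr_le0 ?ler_expR; last by lra.
  by rewrite -lerN2 -mulrN ler_piMl// oppr_ge0 ltW.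
lra.
Qed.

(** Equality holds at m = 0, so the metric there is as short as possible; this
    makes W comparable from below to the Euclidean distance up to the boundary. *)
Lemma mobility_le_half m : -1 <= m <= 1 -> mobility m <= 1 / 2.
Proof.
move=> /[dup] m1 /itvNcc_cases[->|->|m1']; rewrite ?mobilityN1 ?mobility1//.
apply: le_trans (log_mean_le_arithmetic (flow_up_gt0 m1') (flow_down_gt0 m1')) _.
by rewrite ler_pM2r ?invr_gt0// flow_sum_le1.
Qed.

Definition flow_diff1 m : R :=
  (1 - beta) * (expR (beta * m) + expR (- (beta * m))) / 2 +
  beta * m * (expR (beta * m) - expR (- (beta * m))) / 2.

Lemma is_derive_flow_diff m :
  is_derive m 1 (fun x => flow_up x - flow_down x) (flow_diff1 m).
Proof.
rewrite /flow_up /flow_down; apply: is_derive_eq.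
by rewrite /GRing.scale /= /flow_diff1; field.
Qed.

Lemma flow_diff1_ge m : 1 - beta <= flow_diff1 m.
Proof.
rewrite /flow_diff1; have := mulr_expR_subN_ge0 (beta * m).
have e1 := expR_ge1Dx (beta * m); have e2 := expR_ge1Dx (- (beta * m)).
move=> e3; have b1 : 0 <= 1 - beta by rewrite subr_ge0.
have : 2 * (1 - beta) <= (1 - beta) * (expR (beta * m) + expR (- (beta * m))).
  by rewrite mulrC ler_wpM2l//; lra.
lra.
Qed.

Lemma is_derive_entropy1 m : -1 < m < 1 -> is_derive m 1 entropy1 (entropy2 m).
Proof.
move=> m1; have := onem_sqr_gt0 m1; have /andP[? ?] := m1 => h3.
have h1 : 0 < 1 + m by lra.
have h2 : 0 < 1 - m by lra.
have d1 := @is_derive_ln_comp R (fun x : R => 1 + x) m _ h1 _.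
have d2 := @is_derive_ln_comp R (fun x : R => 1 - x) m _ h2 _.
rewrite /entropy1; apply: is_derive_eq; rewrite /GRing.scale /= /entropy2.
by field; rewrite !gt_eqF.
Qed.

Lemma is_derive_entropy m : -1 < m < 1 -> is_derive m 1 entropy (entropy1 m).
Proof.
move=> m1; have /andP[? ?] := m1.
have h1 : 0 < (1 + m) / 2 by lra.
have h2 : 0 < (1 - m) / 2 by lra.
have d1 := @is_derive_ln_comp R (fun x : R => (1 + x) / 2) m _ h1 _.
have d2 := @is_derive_ln_comp R (fun x : R => (1 - x) / 2) m _ h2 _.
rewrite /entropy; apply: is_derive_eq; rewrite /GRing.scale /= /entropy1.
rewrite !ln_div ?posrE//; try lra.
by field; apply/andP; split; rewrite gt_eqF//; lra.
Qed.

Lemma entropy1N m : entropy1 (- m) = - entropy1 m.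
Proof. by rewrite /entropy1 opprK; field. Qed.

Lemma entropyN m : entropy (- m) = entropy m.
Proof. by rewrite /entropy opprK; ring. Qed.

Lemma entropy10 : entropy1 0 = 0.
Proof. by rewrite /entropy1 addr0 subr0 subrr mulr0 mul0r subrr. Qed.

Lemma entropy2_ge0 m : -1 < m < 1 -> 0 <= entropy2 m.
Proof.
move=> m1; rewrite /entropy2 subr_ge0 (le_trans beta_le1)//.
by rewrite invf_ge1 ?onem_sqr_gt0// lerBlDr lerDl sqr_ge0.
Qed.

(** At beta = 1 the second derivative vanishes at 0, so strictness comes from
    the mean value theorem and not from a lower bound on [entropy2]. *)
Lemma entropy1_gt0 m : 0 < m < 1 -> 0 < entropy1 m.
Proof.
move=> /andP[m0 m1].
have dE x : x \in `]0, m[ -> is_derive x 1 entropy1 (entropy2 x).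
  by rewrite in_itv /= => /andP[? ?]; apply: is_derive_entropy1; lra.
have cE : {within `[0, m], continuous entropy1}.
  apply: continuous_in_subspaceT => x; rewrite inE /= in_itv /= => /andP[? ?].
  by apply: is_derive_continuous (is_derive_entropy1 _); lra.
have [c] := MVT m0 dE cE; rewrite in_itv /= entropy10 !subr0 => /andP[c0 cm] ->.
rewrite mulr_gt0// /entropy2 subr_gt0 (le_lt_trans beta_le1)//.
have c1 : -1 < c < 1 by lra.
by rewrite invf_gt1 ?onem_sqr_gt0// ltrBlDr ltrDl exprn_gt0.
Qed.

Lemma entropy1_neq0 m : -1 < m < 1 -> m != 0 -> entropy1 m != 0.
Proof.
move=> /andP[h1 h2]; rewrite neq_lt => /orP[m0|m0].
  rewrite -[m]opprK entropy1N oppr_eq0 gt_eqF// entropy1_gt0//; lra.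
by rewrite gt_eqF// entropy1_gt0// m0.
Qed.

Definition mobility_der m : R :=
  (flow_diff1 m - 2 * mobility m * entropy2 m) / (2 * entropy1 m).

Lemma is_derive_mobility m : -1 < m < 1 -> m != 0 ->
  is_derive m 1 mobility (mobility_der m).
Proof.
move=> m1 m0.
have e0 := entropy1_neq0 m1 m0.
apply: (@near_eq_is_derive _ _ _ (fun x => (flow_up x - flow_down x) / (2 * entropy1 x))).
  near=> x.
  have x1 : -1 < x < 1 by near: x; exact: near_itvN11.
  rewrite -mobility_entropy1// mulfK// mulf_neq0// entropy1_neq0//.
  near: x; have [m0'|m0'|E] := ltgtP m 0; last by rewrite E eqxx in m0.
    by near=> x; rewrite lt_eqF//; near: x; exact: lt_nbhsl.
  by near=> x; rewrite gt_eqF//; near: x; exact: lt_nbhsr.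
have d1 := is_derive_flow_diff m; have d2 := is_derive_entropy1 m1.
have e20 : 2 * entropy1 m != 0 by rewrite mulf_neq0.
apply: is_derive_eq.
rewrite /GRing.scale /= /mobility_der -mobility_entropy1//; field.
by rewrite e0.
Unshelve. all: by end_near. Qed.

(** The quotient formula is singular at m = 0; there the mobility is squeezed
    between sqrt (1 - m^2) / 2 and 1 / 2. *)
Lemma mobility_continuous m : -1 < m < 1 -> {for m, continuous mobility}.
Proof.
have [->|m0] := eqVneq m 0; last first.
  by move=> m1; exact: is_derive_continuous (is_derive_mobility m1 m0).
move=> _.
have M0 : mobility 0 = 1 / 2.
  apply/le_anti; rewrite mobility_le_half; last by lra.
  have := @mobility_ge_sqrt 0; rewrite expr0n /= subr0 sqrtr1; apply; lra.
suff : mobility x @[x --> (0 : R)] --> (1 / 2 : R) by rewrite -M0.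
apply: (@squeeze_cvgr _ (nbhs (0 : R)) _ R
  (fun x : R => Num.sqrt (1 - x * x) / 2) (cst (1 / 2 : R)) mobility).
- near=> x.
  have /andP[x1 x2] : -1 < x < 1 by near: x; apply: near_itvN11; lra.
  rewrite mobility_le_half ?andbT; last by rewrite !ltW.
  by rewrite -expr2 mobility_ge_sqrt ?x1.
- have {1}-> : 1 / 2 = (fun x : R => Num.sqrt (1 - x * x) / 2) 0.
    by rewrite mulr0 subr0 sqrtr1.
  apply: (@continuousM _ R (fun x : R => Num.sqrt (1 - x * x)) (cst 2^-1)).
    apply: (@continuous_comp _ _ _ (fun x : R => 1 - x * x) Num.sqrt).
      exact: (@is_derive_continuous _ _ _ _ (@is_deriveB _ _ _ _ _ _ _ _ _ _ _)).
    exact: sqrt_continuous.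
  exact: cst_continuous.
- exact: cvg_cst.
Unshelve. all: by end_near. Qed.

(** The derivative of the free energy with respect to arc length. *)
Definition slope m : R := 2 * Num.sqrt (mobility m) * entropy1 m.

Lemma slope_continuous m : -1 < m < 1 -> {for m, continuous slope}.
Proof.
move=> m1; apply: continuousM; last first.
  exact: is_derive_continuous (is_derive_entropy1 m1).
apply: continuousM; first exact: cst_continuous.
apply: continuous_comp; [exact: mobility_continuous|exact: sqrt_continuous].
Qed.

(** Dividing this derivative by that of the arc length leaves the second
    derivative of the free energy along geodesics. *)
Lemma is_derive_slope m : -1 < m < 1 -> m != 0 ->
  is_derive m 1 slope
    ((flow_diff1 m + 2 * mobility m * entropy2 m) / (2 * Num.sqrt (mobility m))).
Proof.
move=> m1 m0.
have d1 := is_derive_mobility m1 m0; have d2 := is_derive_entropy1 m1.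
have M0 := mobility_gt0 m1.
have d3 := is_derive_sqrt_comp M0 d1.
have s0 : Num.sqrt (mobility m) != 0 by rewrite gt_eqF// sqrtr_gt0.
have e0 := entropy1_neq0 m1 m0.
rewrite /slope; apply: is_derive_eq.
rewrite /GRing.scale /= /mobility_der.
have ME := esym (sqr_sqrtr (ltW M0)).
set S := Num.sqrt (mobility m) in s0 ME *.
rewrite ME; clearbody S; field.
by rewrite s0 e0.
Qed.

(** The heart of the curvature bound.  With s = sqrt (1 - m^2) <= 1, the second
    term is at least s (1 / s^2 - beta) = 1 / s - beta s >= 1 - beta. *)
Lemma slope_der_ge m : -1 < m < 1 ->
  2 * (1 - beta) <= flow_diff1 m + 2 * mobility m * entropy2 m.
Proof.
move=> m1; rewrite mulrDl mul1r lerD ?flow_diff1_ge//.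
have h := onem_sqr_gt0 m1.
set s := Num.sqrt (1 - m ^+ 2).
have s0 : 0 < s by rewrite sqrtr_gt0.
have ss : s * s = 1 - m ^+ 2 by rewrite -expr2 sqr_sqrtr// ltW.
have s1 : s <= 1.
  by rewrite -sqrtr1 ler_wsqrtr// lerBlDr lerDl sqr_ge0.
apply: (@le_trans _ _ (s * entropy2 m)); last first.
  rewrite ler_wpM2r ?entropy2_ge0//.
  by have := mobility_ge_sqrt m1; rewrite -/s; lra.
rewrite /entropy2 -ss.
have -> : s * ((s * s)^-1 - beta) = s^-1 - beta * s by field; rewrite gt_eqF.
have : 1 <= s^-1 by rewrite invf_ge1.
have : beta * s <= beta by rewrite ler_piMr.
lra.
Qed.

End curie_weiss_functions.

(** * Smooth functions with prescribed support *)

Section smooth_functions.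
Context {R : realType}.
Implicit Types (f g : R -> R) (P : {poly R}) (a b x y : R).

Definition smooth f := forall k x, derivable (derive1n k f) x 1.

Lemma smooth_derivable f x : smooth f -> derivable f x 1.
Proof. by move=> /(_ 0%N x). Qed.

Lemma smooth_is_derive f x : smooth f -> is_derive x 1 f ((derive1 f) x).
Proof. by move=> /smooth_derivable sf; rewrite derive1E; exact: derivableP. Qed.

Lemma smooth_continuous f : smooth f -> continuous f.
Proof. by move=> sf x; exact: is_derive_continuous (smooth_is_derive x sf). Qed.

Lemma smooth_derive1 f : smooth f -> smooth (derive1 f).
Proof. by move=> sf k x; rewrite -derive1Sn; exact: sf. Qed.

Lemma smooth_primitive f g : (forall x, is_derive x 1 f (g x)) -> smooth g -> smooth f.
Proof.
move=> fg sg.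
have gE : derive1 f = g.
  by apply/funext => x; rewrite derive1E; case: (fg x).
by move=> [|k] x; [case: (fg x)|rewrite derive1Sn gE; exact: sg].
Qed.

Lemma smoothZ (c : R) f : smooth f -> smooth (fun x => c * f x).
Proof.
have dZ g y : smooth g -> is_derive y 1 (fun x => c * g x) (c * derive1 g y).
  by move=> /smooth_is_derive => /(_ y) d; apply: is_derive_eq.
move=> sf k; elim: k f sf => [|k IH] f sf x; first by case: (dZ f x sf).
rewrite derive1Sn.
have -> : derive1 (fun x => c * f x) = (fun x => c * derive1 f x).
  by apply/funext => z; rewrite derive1E; case: (dZ f z sf).
exact/IH/smooth_derive1.
Qed.

Lemma smoothB f g : smooth f -> smooth g -> smooth (fun x => f x - g x).
Proof.
have dB u v y : smooth u -> smooth v ->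
    is_derive y 1 (fun x => u x - v x) (derive1 u y - derive1 v y).
  move=> /smooth_is_derive => /(_ y) d1 /smooth_is_derive => /(_ y) d2.
  exact: is_derive_eq.
move=> sf sg k; elim: k f g sf sg => [|k IH] f g sf sg x.
  by case: (dB f g x sf sg).
rewrite derive1Sn.
have -> : derive1 (fun x => f x - g x) = (fun x => derive1 f x - derive1 g x).
  by apply/funext => z; rewrite derive1E; case: (dB f g z sf sg).
by apply: IH; exact: smooth_derive1.
Qed.

(** Gives the derivative of a bump at the edge of its support, where no formula
    is available on both sides. *)
Lemma is_derive0_quadratic f (C : R) x : f x = 0 ->
  (forall y, `|f y| <= C * (y - x) ^+ 2) -> is_derive x 1 f 0.
Proof.
move=> fx0 fC.
suff H : h^-1 *: ((f \o shift x) (h *: (1 : R)) - f x) @[h --> (0 : R)^'] --> (0 : R).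
  by apply: DeriveDef; [apply/cvg_ex; exists 0 | exact: cvg_lim].
apply: norm_cvg0.
apply: (@squeeze_cvgr _ _ _ _ (cst 0) (fun h : R => C * `|h|)).
- near=> h.
  have h0 : h != 0 by near: h; exact: nbhs_dnbhs_neq.
  rewrite normr_ge0 /= fx0 subr0 /GRing.scale /= mulr1 normrM normfV.
  rewrite ler_pdivrMl ?normr_gt0//.
  apply: le_trans (fC _) _.
  by rewrite addrK -[h ^+ 2]real_normK ?num_real// mulrCA.
- exact: cvg_cst.
- suff : C * `|h| @[h --> (0 : R)^'] --> C * `|0 : R| by rewrite normr0 mulr0.
  apply: cvg_within_filter; apply: cvgM; first exact: cvg_cst.
  exact: (@norm_continuous _ _ (0 : R)).
Unshelve. all: by end_near. Qed.

Definition bump_poly a b : {poly R} := ('X - a%:P) * (b%:P - 'X).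

(** With w = (x - a)(b - x), the functions P(x) w^-n exp(-1/w), extended by 0,
    form a family that is stable under differentiation.  Smoothness of all its
    members then follows by a single induction on the order. *)
Definition flat a b P n x : R :=
  if a < x < b then
    P.[x] * (bump_poly a b).[x]^-1 ^+ n * expR (- (bump_poly a b).[x]^-1)
  else 0.

Lemma bump_polyE a b x : (bump_poly a b).[x] = (x - a) * (b - x).
Proof. by rewrite /bump_poly !hornerE. Qed.

Lemma expr_expRN_le n (u : R) : 0 <= u -> u ^+ n * expR (- u) <= n`!%:R.
Proof.
move=> u0; rewrite expRN ler_pdivrMr ?expR_gt0//.
case: n => [|n]; first by rewrite expr0 fact0 mul1r -expR0 ler_expR.
rewrite -ler_pdivrMl ?ltr0n ?fact_gt0// mulrC.
by apply: le_trans (expR_ge1Dxn n u0); rewrite lerDr.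
Qed.

(** On the support, w^-n exp(-1/w) = w^2 (w^-(n+2) exp(-1/w)) is bounded by a
    multiple of w^2, and w is at most (b - a) times the distance to any point
    outside ]a, b[. *)
Lemma flat_quadratic a b P n x : ~~ (a < x < b) ->
  exists C, forall y, `|flat a b P n y| <= C * (y - x) ^+ 2.
Proof.
move=> xab.
have [ba|ab] := leP b a.
  exists 0 => y; rewrite mul0r /flat ifF ?normr0//.
  by apply/negbTE/negP => /andP[h1 h2]; have := lt_trans h1 h2; rewrite ltNge ba.
have cP : {within `[a, b], continuous (fun y => `|P.[y]|)}.
  apply: continuous_subspaceT => y.
  by apply: (continuous_comp (@continuous_horner _ P y)); exact: norm_continuous.
have [z _ Pz] := EVT_max (ltW ab) cP.
exists (`|P.[z]| * (n.+2)`!%:R * (b - a) ^+ 2) => y.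
rewrite /flat; case: ifP => [yab|_]; last first.
  rewrite normr0.
  exact: mulr_ge0 (mulr_ge0 (mulr_ge0 (normr_ge0 _) (ler0n _ _)) (sqr_ge0 _)) (sqr_ge0 _).
have /andP[ay yb] := yab.
rewrite bump_polyE.
set w := (y - a) * (b - y).
have w0 : 0 < w by rewrite mulr_gt0 ?subr_gt0.
have wle : w <= (b - a) * `|y - x|.
  move: xab; rewrite negb_and -!leNgt => /orP[xa|bx].
    rewrite ger0_norm; last by rewrite subr_ge0 (le_trans xa) ?ltW.
    by rewrite /w mulrC; apply: ler_pM; lra.
  rewrite ler0_norm; last by rewrite subr_le0 (le_trans _ bx) ?ltW.
  by rewrite /w; apply: ler_pM; lra.
rewrite !normrM -!mulrA ler_pM//.
  by apply: Pz; rewrite in_itv /= !ltW.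
have -> : `|w^-1 ^+ n| * `|expR (- w^-1)| = w ^+ 2 * (w^-1 ^+ n.+2 * expR (- w^-1)).
  rewrite !ger0_norm ?expR_ge0 ?exprn_ge0 ?invr_ge0 ?(ltW w0)//.
  rewrite (exprS _ n.+1) (exprS _ n); move: (w^-1 ^+ n) (expR _) => A B.
  by field; rewrite gt_eqF.
rewrite mulrC; apply: ler_pM.
- by rewrite mulr_ge0 ?expR_ge0 ?exprn_ge0 ?invr_ge0 ?(ltW w0).
- exact: sqr_ge0.
- by apply: expr_expRN_le; rewrite invr_ge0 ltW.
rewrite mulrA -expr2 -(real_normK (num_real (y - x))) -exprMn.
apply: lerXn2r => //; rewrite nnegrE; first exact: ltW.
by apply: mulr_ge0 => //; rewrite subr_ge0 ltW.
Qed.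

(** Numerator of the derivative of P w^-n exp(-1/w) over the denominator
    w^(n+2). *)
Definition flat_der a b P n : {poly R} :=
  let W := bump_poly a b in
  P^`() * W ^+ 2 - n%:R *: (P * W^`() * W) + P * W^`().

Lemma is_derive_flat a b P n x :
  is_derive x 1 (flat a b P n) (flat a b (flat_der a b P n) n.+2 x).
Proof.
have [xab|xab] := boolP (a < x < b); last first.
  rewrite {2}/flat (negbTE xab).
  have [C fC] := flat_quadratic P n xab.
  by apply: (is_derive0_quadratic _ fC); rewrite /flat (negbTE xab).
have /andP[ax xb] := xab.
rewrite {2}/flat xab.
set W := bump_poly a b.
apply: (@near_eq_is_derive _ _ _ (fun y =>
   P.[y] * W.[y]^-1 ^+ n * expR (- W.[y]^-1))).
  near=> y; rewrite /flat ifT//; apply/andP; split; near: y.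
    exact: lt_nbhsr.
  exact: lt_nbhsl.
have W0 : W.[x] != 0 by rewrite bump_polyE gt_eqF// mulr_gt0 ?subr_gt0.
rewrite /flat_der -/W; clearbody W.
pose u (y : R) := W.[y]^-1.
have du : is_derive x 1 u (- (u x) ^+ 2 * (W^`()).[x]).
  by rewrite /u; apply: is_derive_eq; rewrite /GRing.scale /= exprVn.
have dun : is_derive x 1 (fun y => u y ^+ n) (- n%:R * u x ^+ n.+1 * (W^`()).[x]).
  elim: n => [|k IH].
    rewrite (_ : (fun y => _) = cst 1)//.
    by apply: is_derive_eq; rewrite mulr0n oppr0 !mul0r.
  under [X in is_derive _ _ X _]eq_fun do rewrite exprS.
  by apply: is_derive_eq; rewrite /GRing.scale /= !exprS -natr1; ring.
have dP : is_derive x 1 (horner P) (P^`()).[x] by exact: is_derive_poly.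
have : is_derive x 1 (fun y => P.[y] * u y ^+ n * expR (- u y)) 
  ((P^`() * W ^+ 2 - n%:R *: (P * W^`() * W) + P * W^`()).[x] * u x ^+ n.+2 *
     expR (- u x)).
  apply: is_derive_eq; rewrite /GRing.scale /=.
  rewrite !(hornerD, hornerN, hornerZ, hornerM, horner_exp).
  have Wu : W.[x] = (u x)^-1 by rewrite /u invrK.
  have u0 : u x != 0 by rewrite /u invr_eq0.
  by rewrite Wu (exprS _ n.+1) (exprS _ n); field.
by [].
Unshelve. all: by end_near. Qed.

Lemma smooth_flat a b P n : smooth (flat a b P n).
Proof.
move=> k; elim: k P n => [|k IH] P n x.
  by rewrite derive1n0; case: (is_derive_flat a b P n x).
rewrite derive1Sn.
have -> : derive1 (flat a b P n) = flat a b (flat_der a b P n) n.+2.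
  by apply/funext => y; rewrite derive1E; case: (is_derive_flat a b P n y).
exact: IH.
Qed.

End smooth_functions.

(** * Smooth steps and weak derivatives *)

Section primitives.
Context {R : realType}.
Implicit Types (f : R -> R) (a b l x y : R).
Notation mu := (@lebesgue_measure R).

Definition primitive l f x : R := \int[mu]_(t in `[l, x]) f t.

Lemma is_derive_primitive l f x : continuous f -> l < x ->
  is_derive x 1 (primitive l f) (f x).
Proof.
move=> cf lx.
have fi : mu.-integrable `[l, x + 1] (EFin \o f).
  by apply: continuous_itv_integrable; exact: continuous_subspaceT.
have xx1 : x < x + 1 by rewrite ltrDl.
have [d dE] := continuous_FTC1_closed xx1 fi lx (cf x).
by rewrite derive1E in dE; exact: (DeriveDef d dE).
Qed.

Lemma primitive_eq0 l f x : (forall t, t <= x -> f t = 0) -> primitive l f x = 0.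
Proof.
move=> f0; rewrite /primitive (@eq_Rintegral _ _ _ _ _ (cst 0)).
  by rewrite Rintegral_cst// mul0r.
by move=> t; rewrite inE /= in_itv /= => /andP[_ /f0].
Qed.

(** The normalized primitive of a bump supported in [a, b]. *)
Lemma smooth_step a b : a < b -> exists eta S : R -> R,
  [/\ smooth eta, forall x, is_derive x 1 S (eta x),
      forall x, 0 <= eta x,
      forall x, eta x != 0 -> a < x < b &
      (forall x, x <= a -> S x = 0) /\ (forall x, b <= x -> S x = 1)].
Proof.
move=> ab.
have [e0 [se0 e0_ge0 e0_le e0_ge e0_gt0]] : exists e0 : R -> R,
    [/\ smooth e0, forall x, 0 <= e0 x, forall x, x <= a -> e0 x = 0,
        forall x, b <= x -> e0 x = 0 & forall x, a < x < b -> 0 < e0 x].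
  exists (flat a b 1 0); split; first exact: smooth_flat.
  - move=> x; rewrite /flat; case: ifP => // _.
    by rewrite hornerC mul1r expr0 mul1r expR_ge0.
  - by move=> x xa; rewrite /flat ltNge xa.
  - by move=> x xb; rewrite /flat andbC ltNge xb.
  - by move=> x xab; rewrite /flat xab hornerC mul1r expr0 mul1r expR_gt0.
have ce0 := smooth_continuous se0.
pose P := primitive (a - 1) e0.
have Pa x : x <= a -> P x = 0.
  by move=> xa; apply: primitive_eq0 => t tx; apply: e0_le; exact: le_trans xa.
have dP x : is_derive x 1 P (e0 x).
  have [xa|xa] := leP a x.
    by apply: is_derive_primitive => //; rewrite ltrBlDr; lra.
  rewrite e0_le ?ltW//.
  apply: (@near_eq_is_derive _ _ _ (cst 0)).
  by near=> y; rewrite Pa// ltW//; near: y; exact: lt_nbhsl.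
have cP x : {for x, continuous P} by exact: is_derive_continuous (dP x).
have Pb0 : 0 < P b.
  have cP' : {within `[a, b], continuous P} by exact: continuous_subspaceT.
  have [c] := MVT ab (fun x _ => dP x) cP'.
  rewrite in_itv /= (Pa a)// subr0 => cab ->; rewrite mulr_gt0 ?subr_gt0//.
  exact: e0_gt0.
have Pb x : b <= x -> P x = P b.
  move=> bx; apply/le_anti/andP; split; last first.
    by apply: (@nondecreasing_is_derive _ P e0).
  rewrite -lerN2; apply: (@nondecreasing_is_derive _ (fun x => - P x) (fun x => - e0 x)) => //.
  - by move=> y _; apply: continuousN; exact: cP.
  - by move=> y /andP[yb _]; rewrite e0_ge ?oppr0// ltW.
exists (fun x => (P b)^-1 * e0 x), (fun x => (P b)^-1 * P x); split.
- exact: smoothZ.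
- by move=> x; have d := dP x; apply: is_derive_eq.
- by move=> x; rewrite mulr_ge0 ?invr_ge0 ?(ltW Pb0).
- move=> x; rewrite mulf_eq0 negb_or => /andP[_ e0x]; apply/andP; split.
    by rewrite ltNge; apply: contra e0x => /e0_le ->.
  by rewrite ltNge; apply: contra e0x => /e0_ge ->.
- by split=> x; [move=> /Pa ->; rewrite mulr0|move=> /Pb ->; rewrite mulVf ?gt_eqF].
Unshelve. all: by end_near. Qed.

Lemma within_continuous_nbhs f (A : set R) x (e : R) : 0 < e -> A x ->
  {within A, continuous f} ->
  exists2 d, 0 < d & forall y, A y -> `|y - x| < d -> `|f y - f x| <= e.
Proof.
move=> e0 Ax /subspace_continuousP /(_ x Ax) /cvgrPdist_le /(_ e e0).
rewrite near_withinE => -[d /= d0 H]; exists d => // y Ay yx.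
by rewrite distrC; apply: H => //=; rewrite distrC.
Qed.

(** The smooth density [g] has mass one on [0, 1], so it averages [f]; it acts
    as an approximate point evaluation. *)
Lemma weight_average_near f (g S : R -> R) (s c : R) :
  smooth g -> (forall x, is_derive x 1 S (g x)) -> (forall x, 0 <= g x) ->
  S 0 = 0 -> S 1 = 1 ->
  {within `[0, 1], continuous f} ->
  (forall x, 0 <= x <= 1 -> g x != 0 -> `|f x - c| <= s) ->
  `|\int[mu]_(x in `[0, 1]) (g x * f x) - c| <= s.
Proof.
move=> sg dS g0 S0 S1 cf fc.
have cg := smooth_continuous sg.
have ig1 : \int[mu]_(x in `[0, 1]) g x = 1.
  by rewrite (Rintegral_is_derive ler01 cg dS) S0 S1 subr0.
have ig : mu.-integrable `[0, 1] (EFin \o g).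
  by apply: continuous_itv_integrable; exact: continuous_subspaceT.
have igc (r : R) : mu.-integrable `[0, 1] (EFin \o (fun x => g x * r)).
  apply: continuous_itv_integrable; apply: continuous_subspaceT => x.
  by apply: cvgM; [exact: cg|exact: cvg_cst].
have igf : mu.-integrable `[0, 1] (EFin \o (fun x => g x * f x)).
  apply: continuous_itv_integrable => x; apply: cvgM; last exact: cf.
  exact: continuous_subspaceT.
have -> : c = \int[mu]_(x in `[0, 1]) (g x * c) by rewrite RintegralZr// ig1 mul1r.
rewrite -RintegralB//.
have igfc : mu.-integrable `[0, 1] (EFin \o (fun x => g x * f x - g x * c)).
  exact: (integrableB _ igf (igc c)).
apply: le_trans (le_normr_Rintegral _ igfc) _ => //.
have -> : s = \int[mu]_(x in `[0, 1]) (g x * s) by rewrite RintegralZr// ig1 mul1r.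
apply: le_Rintegral => //.
  exact: (integrable_abse igfc).
move=> x; rewrite /= in_itv /= => x01.
rewrite -mulrBr normrM ger0_norm//.
have [->|gx0] := eqVneq (g x) 0; first by rewrite !mul0r.
by rewrite ler_wpM2l// fc.
Qed.

Lemma test_function_0 (phi : R -> R) (t : R) :
  test_function phi -> (t <= 0) || (1 <= t) -> phi t = 0.
Proof.
move=> [_ cl] t01; apply/eqP/negP => /negP pt.
have : `]0, 1[%classic t by apply: cl; exact: subset_closure.
by rewrite /= in_itv /= !ltNge; case/orP: t01 => ->; rewrite ?andbF.
Qed.

(** The test function is a smooth step up just after s minus a smooth step up
    just before t.  Its derivative approximates the difference of two Dirac
    masses, which recovers m t - m s, and it is bounded by 1 and supported in
    [s, t], which bounds the right-hand side. *)
Lemma weak_derivative_increment (m j : R -> R) (s t : R) :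
  {within `[0, 1], continuous m} ->
  mu.-integrable `[0, 1] (EFin \o j) ->
  (forall phi : R -> R, test_function phi ->
    - (\int[mu]_(x in `[0, 1]) (derive1 phi x * m x))
    + \int[mu]_(x in `[0, 1]) (phi x * j x) = 0) ->
  0 <= s -> s < t -> t <= 1 ->
  `|m t - m s| <= \int[mu]_(x in `[s, t]) `|j x|.
Proof.
move=> cm ij weak s0 st t1.
apply/ler_addgt0Pr => e e0.
have e20 : 0 < e / 2 by rewrite divr_gt0.
have As : `[0, 1]%classic s by rewrite /= in_itv /= s0 (le_trans (ltW st)).
have At : `[0, 1]%classic t by rewrite /= in_itv /= t1 (le_trans s0 (ltW st)).
have [d1 d10 H1] := within_continuous_nbhs e20 As cm.
have [d2 d20 H2] := within_continuous_nbhs e20 At cm.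
(* a third of the smallest scale leaves room for both steps in [s, t] *)
pose d := Num.min (Num.min d1 d2) (t - s) / 3.
have d0 : 0 < d by rewrite divr_gt0// !lt_min d10 d20 subr_gt0.
have dd1 : 3 * d <= d1 by rewrite /d mulrC divfK// !ge_min lexx.
have dd2 : 3 * d <= d2 by rewrite /d mulrC divfK// !ge_min lexx orbT.
have dts : 3 * d <= t - s by rewrite /d mulrC divfK// ge_min lexx orbT.
have [g1 [S1 [sg1 dS1 g10 g1N0 [S10 S11]]]] := @smooth_step (s + d) (s + 2 * d) ltac:(lra).
have [g2 [S2 [sg2 dS2 g20 g2N0 [S20 S21]]]] := @smooth_step (t - 2 * d) (t - d) ltac:(lra).
have S_01 (g S : R -> R) (a b : R) : a <= b ->
    (forall x, is_derive x 1 S (g x)) -> (forall x, 0 <= g x) ->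
    (forall x, x <= a -> S x = 0) -> (forall x, b <= x -> S x = 1) ->
    forall x, 0 <= S x <= 1.
  move=> ab dS g0 Sa Sb x.
  have Smono u v : u <= v -> S u <= S v.
    move=> uv; apply: (@nondecreasing_is_derive _ S g) => // y _.
    exact: is_derive_continuous (dS y).
  have [xa|xa] := leP x a; first by rewrite Sa// lexx ler01.
  have [xb|xb] := leP b x; first by rewrite Sb// lexx ler01.
  by rewrite -(Sa a)// -(Sb b)// !Smono ?ltW.
have S1_01 := S_01 g1 S1 (s + d) (s + 2 * d) ltac:(lra) dS1 g10 S10 S11.
have S2_01 := S_01 g2 S2 (t - 2 * d) (t - d) ltac:(lra) dS2 g20 S20 S21.
pose phi x := S1 x - S2 x.
have dphi x : is_derive x 1 phi (g1 x - g2 x).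
  by have e1 := dS1 x; have e2 := dS2 x; apply: is_derive_eq.
have phi0 x : phi x != 0 -> s + d <= x <= t - d.
  rewrite /phi => px; apply/andP; split; rewrite leNgt; apply/negP => h.
    by move: px; rewrite S10 ?S20 ?subrr ?eqxx//; lra.
  by move: px; rewrite S11 ?S21 ?subrr ?eqxx//; lra.
have sphi : smooth phi.
  by apply: (smooth_primitive dphi); exact: smoothB.
have tphi : test_function phi.
  split; first exact: sphi.
  apply: (@subset_trans _ `[s + d, t - d]%classic).
    have clI : closed `[s + d, t - d]%classic by exact: interval_closed.
    by rewrite ((closure_id _).1 clI); apply: closure_subset => x /= /phi0; rewrite in_itv.
  by move=> x; rewrite /= !in_itv /= => /andP[? ?]; apply/andP; split; lra.
have phi1 x : `|phi x| <= 1.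
  have /andP[? ?] := S1_01 x; have /andP[? ?] := S2_01 x.
  by rewrite /phi ler_norml; apply/andP; split; lra.
have iphi : derive1 phi = (fun x => g1 x - g2 x).
  by apply/funext => x; rewrite derive1E; case: (dphi x).
have igm g : smooth g -> mu.-integrable `[0, 1] (EFin \o (fun x => g x * m x)).
  move=> sg; apply: continuous_itv_integrable => x; apply: cvgM; last exact: cm.
  have cg := smooth_continuous sg.
  exact: continuous_subspaceT.
have := weak _ tphi; rewrite iphi.
have -> : \int[mu]_(x in `[0, 1]) ((g1 x - g2 x) * m x) =
    \int[mu]_(x in `[0, 1]) (g1 x * m x) - \int[mu]_(x in `[0, 1]) (g2 x * m x).
  rewrite -RintegralB//; last 2 first.
  - exact: igm.
  - exact: igm.
  by apply: eq_Rintegral => x _; rewrite mulrBl.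
have A1 : `|\int[mu]_(x in `[0, 1]) (g1 x * m x) - m s| <= e / 2.
  apply: (@weight_average_near m g1 S1) => //.
  - by apply: S10; lra.
  - by apply: S11; lra.
  move=> x x01 /g1N0 /andP[? ?]; apply: H1; first by rewrite /= in_itv.
  by rewrite ltr_norml; apply/andP; split; lra.
have A2 : `|\int[mu]_(x in `[0, 1]) (g2 x * m x) - m t| <= e / 2.
  apply: (@weight_average_near m g2 S2) => //.
  - by apply: S20; lra.
  - by apply: S21; lra.
  move=> x x01 /g2N0 /andP[? ?]; apply: H2; first by rewrite /= in_itv.
  by rewrite ltr_norml; apply/andP; split; lra.
have ij' : mu.-integrable `[0, 1] (EFin \o (fun x => `|j x|)) by exact: (integrable_abse ij).
have ijst : mu.-integrable `[s, t] (EFin \o (fun x => `|j x|)).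
  apply: integrableS ij' => //; apply: subset_itv; rewrite bnd_simp; lra.
have A3 : `|\int[mu]_(x in `[0, 1]) (phi x * j x)| <= \int[mu]_(x in `[s, t]) `|j x|.
  have iphij : mu.-integrable `[0, 1] (EFin \o (fun x => phi x * j x)).
    apply: (le_integrable _ _ _ ij) => //.
      apply/measurable_EFinP/measurable_funM.
        by apply: measurable_funTS; apply: continuous_measurable_fun; exact: smooth_continuous.
      by apply/measurable_EFinP; exact: (measurable_int _ ij).
    move=> x _; rewrite /= lee_fin normrM ler_piMl//.
  apply: le_trans (le_normr_Rintegral _ iphij) _ => //.
  have st01 : `[s, t]%classic `<=` `[0, 1]%classic.
    by apply: subset_itv; rewrite bnd_simp; lra.
  rewrite -(setIidr st01).
  rewrite Rintegral_mkcondr; apply: le_Rintegral => //.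
  - exact: (integrable_abse iphij).
  - by rewrite -restrict_EFin; apply/integrable_restrict => //; rewrite (setIidr st01).
  move=> x _; rewrite patchE; case: ifPn => [_|].
    by rewrite normrM ler_piMl.
  rewrite notin_setE /= in_itv /= => /negP xst.
  have [->|/phi0 /andP[? ?]] := eqVneq (phi x) 0; first by rewrite mul0r normr0.
  by exfalso; move/negP: xst; apply; apply/andP; split; lra.
move: A1 A2 A3; rewrite !ler_norml.
set I1 := Rintegral _ _ _; set I2 := Rintegral _ _ _; set I3 := Rintegral _ _ _.
set I4 := Rintegral _ _ _.
move=> /andP[? ?] /andP[? ?] /andP[? ?] ?.
by apply/andP; split; lra.
Qed.

End primitives.

(** * Length and energy of curves *)

Section length.
Context {R : realType}.
Implicit Types (f : R -> R) (a b l x y : R).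
Notation mu := (@lebesgue_measure R).

(** A transitive relation between times that holds near every point holds between
    the end points: consider the supremum of the times related to 0. *)
Lemma unit_interval_chain (Phi : R -> R -> Prop) :
  (forall s t u, 0 <= s -> s <= t -> t <= u -> u <= 1 ->
     Phi s t -> Phi t u -> Phi s u) ->
  (forall z, 0 <= z <= 1 -> exists2 e, 0 < e & forall s t,
     0 <= s -> s <= t -> t <= 1 -> `|s - z| < e -> `|t - z| < e -> Phi s t) ->
  Phi 0 1.
Proof.
move=> Ptrans Ploc.
pose A := [set t | 0 <= t <= 1 /\ Phi 0 t].
have A0 : A 0.
  split; first by rewrite lexx ler01.
  have [|e e0] := Ploc 0; first by rewrite lexx ler01.
  by apply; rewrite ?subrr ?normr0.
have ubA : ubound A 1 by move=> t [/andP[]].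
have supA : has_sup A by split; [exists 0|exists 1].
have T0 : 0 <= sup A by apply: ub_le_sup => //; exists 1.
have T1 : sup A <= 1 by apply: ge_sup => //; exists 0.
have [|e e0 He] := Ploc (sup A); first by rewrite T0 T1.
have [t [/andP[t0 t1] Pt] tT] := sup_adherent e0 supA.
have tleT : t <= sup A by apply: ub_le_sup; [exists 1 | split; rewrite ?t0].
pose u := Num.min 1 (sup A + e / 2).
have u1 : u <= 1 by rewrite ge_min lexx.
have Tu : sup A <= u by rewrite le_min T1 lerDl divr_ge0// ltW.
have uT : u <= sup A + e / 2 by rewrite ge_min lexx orbT.
have Pu : Phi 0 u.
  apply: (Ptrans 0 t u) => //; first exact: le_trans Tu.
  apply: He => //; first exact: le_trans Tu.
    by rewrite ltr_norml; apply/andP; split; lra.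
  by rewrite ltr_norml; apply/andP; split; lra.
have uA : u <= sup A.
  apply: ub_le_sup; first by exists 1.
  by split=> //; rewrite u1 andbT (le_trans T0).
have -> : 1 = u; last by [].
apply/esym/eqP; rewrite eq_le u1 leNgt /=; apply/negP => ult.
move: uA; rewrite /u /Num.min; case: ifPn => h; last by lra.
by move: ult; rewrite /u /Num.min h ltxx.
Qed.

Lemma Rintegral_cat f (s t u : R) : s <= t -> t <= u ->
  mu.-integrable `[s, u] (EFin \o f) ->
  \int[mu]_(x in `[s, u]) f x =
  \int[mu]_(x in `[s, t]) f x + \int[mu]_(x in `[t, u]) f x.
Proof.
move=> st tu fi.
rewrite -(@Rintegral_itv_obnd_cbnd R t); last first.
  by apply: integrableS fi => //; apply: subset_itv; rewrite bnd_simp.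
by rewrite -(@Rintegral_itvB R f (BLeft s) (BRight u) t) ?bnd_simp//; ring.
Qed.

Lemma integrable_subitv f (s t : R) : 0 <= s -> t <= 1 ->
  mu.-integrable `[0, 1] (EFin \o f) -> mu.-integrable `[s, t] (EFin \o f).
Proof.
by move=> s0 t1 fi; apply: integrableS fi => //; apply: subset_itv; rewrite bnd_simp.
Qed.

(** [S] is an arc-length function with density [w], [J] bounds the speed of [m]
    and [L] bounds its length density.  On a short time interval [w] is constant
    along the curve up to eta, so the mean value theorem compares the increment
    of [S] with the integral of L + eta J; these comparisons are chained and eta
    tends to 0. *)
Lemma curve_length_ge (m J L w S : R -> R) :
  {within `[0, 1], continuous m} ->
  mu.-integrable `[0, 1] (EFin \o J) -> mu.-integrable `[0, 1] (EFin \o L) ->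
  (forall x, 0 <= x <= 1 -> 0 <= J x) ->
  (forall s t, 0 <= s -> s < t -> t <= 1 ->
     `|m t - m s| <= \int[mu]_(x in `[s, t]) J x) ->
  continuous w -> (forall x, is_derive x 1 S (w x)) ->
  (forall x, 0 <= x <= 1 -> `|w (m x)| * J x <= L x) ->
  `|S (m 1) - S (m 0)| <= \int[mu]_(x in `[0, 1]) L x.
Proof.
move=> cm iJ iL J0 mJ cw dS wJL.
have cS x : {for x, continuous S} by exact: is_derive_continuous (dS x).
apply/ler_addgt0Pr => e e0.
(* adding 1 keeps K positive when J vanishes *)
pose K := \int[mu]_(x in `[0, 1]) J x + 1.
have IJ0 : 0 <= \int[mu]_(x in `[0, 1]) J x.
  by apply: Rintegral_ge0 => x; rewrite /= in_itv /=; exact: J0.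
have K0 : 0 < K by rewrite ltr_wpDl.
pose eta := e / K.
have eta0 : 0 < eta by rewrite divr_gt0.
have iE : mu.-integrable `[0, 1] (EFin \o (fun x => L x + eta * J x)).
  have iJ' : mu.-integrable `[0, 1] (EFin \o (fun x => eta * J x)).
    exact: (integrableZl _ eta iJ).
  exact: (integrableD _ iL iJ').
suff H : `|S (m 1) - S (m 0)| <= \int[mu]_(x in `[0, 1]) (L x + eta * J x).
  apply: le_trans H _; rewrite RintegralD//; last exact: (integrableZl _ eta iJ).
  rewrite RintegralZl// lerD2l /eta -mulrA ler_piMr ?(ltW e0)//.
  by rewrite mulrC ler_pdivrMr// mul1r /K lerDl.
pose Phi s t := `|S (m t) - S (m s)| <= \int[mu]_(x in `[s, t]) (L x + eta * J x).
apply: (@unit_interval_chain Phi).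
  move=> s t u s0 st tu u1 P1 P2.
  rewrite /Phi (@Rintegral_cat _ s t u)//; last exact: integrable_subitv.
  have -> : S (m u) - S (m s) = (S (m t) - S (m s)) + (S (m u) - S (m t)) by ring.
  exact: le_trans (ler_normD _ _) (lerD P1 P2).
move=> z z01.
have eta20 : 0 < eta / 2 by rewrite divr_gt0.
have := cw (m z) => /cvgrPdist_le /(_ _ eta20) [r /= r0 Hw].
have Az : `[0, 1]%classic z by rewrite /= in_itv.
have r20 : 0 < r / 2 by rewrite divr_gt0.
have [d d0 Hd] := within_continuous_nbhs r20 Az cm.
exists d => // s t s0; rewrite le_eqVlt => /predU1P[<- s1 _ _|st t1 sz tz].
  rewrite /Phi subrr normr0; apply: Rintegral_ge0 => x; rewrite /= in_itv /= => sxs.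
  have x01 : 0 <= x <= 1 by apply/andP; split; lra.
  have := J0 _ x01; have := wJL _ x01 => h1 h2.
  have := mulr_ge0 (normr_ge0 (w (m x))) h2.
  have := mulr_ge0 (ltW eta0) h2; lra.
have mnear x : s <= x <= t -> `|m x - m z| <= r / 2.
  move=> /andP[sx xt]; apply: Hd.
    by rewrite /= in_itv /=; apply/andP; split; lra.
  move: sz tz; rewrite !ltr_norml => /andP[? ?] /andP[? ?].
  by apply/andP; split; lra.
have wnear y : `|y - m z| <= r / 2 -> `|w (m z) - w y| <= eta / 2.
  by move=> yz; apply: Hw => /=; rewrite distrC (le_lt_trans yz)//; lra.
rewrite /Phi; have [xi xi_near ->] : exists2 xi, `|xi - m z| <= r / 2 &
    `|S (m t) - S (m s)| = `|w xi| * `|m t - m s|.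
  have := mnear s; have := mnear t; rewrite !lexx (ltW st) => /(_ isT) ht /(_ isT) hs.
  move: ht hs; rewrite !ler_norml => /andP[? ?] /andP[? ?].
  have [h|h] := leP (m s) (m t).
    have [c + ->] := MVT_segment h (fun x _ => dS x) (continuous_subspaceT cS).
    rewrite in_itv /= normrM => /andP[? ?]; exists c => //.
    by rewrite ler_norml; apply/andP; split; lra.
  have [c + E] := MVT_segment (ltW h) (fun x _ => dS x) (continuous_subspaceT cS).
  rewrite in_itv /= => /andP[? ?]; exists c.
    by rewrite ler_norml; apply/andP; split; lra.
  by rewrite distrC E normrM (distrC (m s)).
apply: (@le_trans _ _ (`|w xi| * \int[mu]_(x in `[s, t]) J x)).
  by rewrite ler_wpM2l// mJ.
rewrite -RintegralZl//; last by apply: integrable_subitv => //.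
apply: le_Rintegral => //.
- have iJst := integrable_subitv s0 t1 iJ; exact: (integrableZl _ `|w xi| iJst).
- exact: integrable_subitv.
move=> x; rewrite /= in_itv /= => sxt.
have x01 : 0 <= x <= 1 by move/andP: sxt => [? ?]; apply/andP; split; lra.
have h1 := wnear _ (mnear _ sxt); have h2 := wnear _ xi_near.
have h3 : `|w xi| <= `|w (m x)| + eta.
  have -> : w xi = w (m x) + ((w (m z) - w (m x)) - (w (m z) - w xi)) by ring.
  apply: le_trans (ler_normD _ _) _; rewrite lerD2l.
  by apply: le_trans (ler_normB _ _) _; lra.
apply: le_trans (ler_wpM2r (J0 _ x01) h3) _.
by rewrite mulrDl lerD2r wJL.
Qed.

(** The Cauchy-Schwarz inequality on [0, 1], obtained by integrating
    2 D L - D^2 <= L^2 <= A, which also covers an infinite energy. *)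
Lemma length_le_sqrt_energy (A L : R -> R) (D : R) : 0 <= D ->
  D <= \int[mu]_(x in `[0, 1]) L x ->
  mu.-integrable `[0, 1] (EFin \o L) ->
  measurable_fun (`[0, 1]%classic : set R) A ->
  (forall x, 0 <= x <= 1 -> 0 <= L x) ->
  (forall x, 0 <= x <= 1 -> L x ^+ 2 <= A x) ->
  (D%:E <= sqrte (\int[mu]_(x in `[0%R, 1%R]) (A x)%:E))%E.
Proof.
move=> D0 DL iL mA L0 LA.
have A0 x : 0 <= x <= 1 -> 0 <= A x.
  by move=> x01; apply: le_trans (LA x x01); exact: sqr_ge0.
suff H : ((D ^+ 2)%:E <= \int[mu]_(x in `[0%R, 1%R]) (A x)%:E)%E.
  have -> : D = Num.sqrt (D ^+ 2) by rewrite sqrtr_sqr ger0_norm.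
  rewrite -[(Num.sqrt _)%:E]/(sqrte (D ^+ 2)%:E) lee_sqrt//.
  by apply: integral_ge0 => x; rewrite /= in_itv /= lee_fin; exact: A0.
have iDL : mu.-integrable `[0, 1] (EFin \o (fun x => 2 * D * L x)).
  exact: (integrableZl _ (2 * D) iL).
have H1 : (\int[mu]_(x in `[0%R, 1%R]) (2 * D * L x)%:E <=
   \int[mu]_(x in `[0%R, 1%R]) (A x + D ^+ 2)%:E)%E.
  apply: ge0_le_integral => //.
  - move=> x; rewrite /= in_itv /= => x01; rewrite lee_fin.
    by apply: mulr_ge0; [exact: mulr_ge0 | exact: L0].
  - exact: (measurable_int _ iDL).
  - by apply/measurable_EFinP; apply: measurable_funD => //; exact: measurable_cst.
  - move=> x; rewrite /= in_itv /= => x01; rewrite lee_fin.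
    have := LA x x01; have := sqr_ge0 (L x - D); rewrite sqrrB; lra.
have H2 : (\int[mu]_(x in `[0%R, 1%R]) (A x + D ^+ 2)%:E =
    \int[mu]_(x in `[0%R, 1%R]) (A x)%:E + (D ^+ 2)%:E)%E.
  under eq_integral do rewrite EFinD.
  rewrite ge0_integralD//; last 2 first.
  - exact/measurable_EFinP.
  - by move=> x _; rewrite lee_fin sqr_ge0.
  congr (_ + _)%E.
  rewrite integral_cst//= lebesgue_measure_itv /= lte_fin ltr01 oppr0 adde0.
  by rewrite mule1.
have H3 : (\int[mu]_(x in `[0%R, 1%R]) (2 * D * L x)%:E =
    (2 * D * \int[mu]_(x in `[0, 1]) L x)%:E)%E.
  rewrite -RintegralZl// /Rintegral fineK//.
  exact: integrable_fin_num iDL.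
move: H1; rewrite H2 H3.
have : (0 <= \int[mu]_(x in `[0%R, 1%R]) (A x)%:E)%E.
  by apply: integral_ge0 => x; rewrite /= in_itv /= lee_fin; exact: A0.
case: (integral _ _ _) => [r| |] //= _; last by move=> _; rewrite leey.
rewrite -EFinD !lee_fin => h.
have : D * D <= D * \int[mu]_(x in `[0, 1]) L x by rewrite ler_wpM2l.
move: h; rewrite expr2; move: (Rintegral _ _ _) => I; clear; lra.
Qed.
End length.

(** * The continuity equation on two states *)

Section two_state.
Context {R : realType} (beta : R).
Hypotheses (beta_ge0 : 0 <= beta) (beta_le1 : beta <= 1).
Implicit Types (m x y : R) (mu psi : 'rV[R]_2).
Notation leb := (@lebesgue_measure R).
Notation T := (curie_weiss beta).
Notation theta := (mobility beta).

Definition magnetization mu : R := mu 0 0 - mu 0 1.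
Definition state m : 'rV[R]_2 := \row_i (if i == 0 then (1 + m) / 2 else (1 - m) / 2).

Lemma sum_ord2 (f : 'I_2 -> R) : \sum_i f i = f 0 + f 1.
Proof.
rewrite !big_ord_recl big_ord0 addr0; congr (f _ + f _).
exact/val_inj.
Qed.

Lemma ord2P (P : 'I_2 -> Prop) : P 0 -> P 1 -> forall i, P i.
Proof.
move=> P0 P1 [[|[|//]] i].
  by rewrite (_ : Ordinal i = 0)//; exact/val_inj.
by rewrite (_ : Ordinal i = 1)//; exact/val_inj.
Qed.

Lemma state_magnetization mu : is_prob mu -> state (magnetization mu) = mu.
Proof.
move=> [_]; rewrite sum_ord2 => mu1.
by apply/rowP; apply: ord2P; rewrite !mxE /= /magnetization; lra.
Qed.

Lemma magnetization_state m : magnetization (state m) = m.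
Proof. by rewrite /magnetization !mxE /=; field. Qed.

Lemma state0 m : state m 0 0 = (1 + m) / 2. Proof. by rewrite mxE. Qed.
Lemma state1 m : state m 0 1 = (1 - m) / 2. Proof. by rewrite mxE. Qed.

Lemma magnetization_itv mu : is_prob mu -> -1 <= magnetization mu <= 1.
Proof.
move=> [mu0]; rewrite sum_ord2 => mu1.
have := mu0 0; have := mu0 1; rewrite /magnetization => h1 h2.
by apply/andP; split; lra.
Qed.

Lemma is_prob_state m : -1 <= m <= 1 -> is_prob (state m).
Proof.
move=> /andP[h1 h2]; split; last by rewrite sum_ord2 !mxE /=; field.
by apply: ord2P; rewrite mxE /=; lra.
Qed.

Lemma rate_state01 m : cw_Q beta (state m) 0 1 = expR (- (beta * m)).
Proof. by rewrite mxE /= /glauber_rate /= -/(magnetization (state m)) magnetization_state. Qed.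

Lemma rate_state10 m : cw_Q beta (state m) 1 0 = expR (beta * m).
Proof. by rewrite mxE /= /glauber_rate /= -/(magnetization (state m)) magnetization_state. Qed.

Lemma Lambda_state01 m : Lambda T (state m) 0 1 = theta m.
Proof. by rewrite mxE /= rate_state01 rate_state10 state0 state1. Qed.

Lemma Lambda_state10 m : -1 <= m <= 1 -> Lambda T (state m) 1 0 = theta m.
Proof.
move=> m1; rewrite mxE /= rate_state01 rate_state10 state0 state1.
by rewrite log_meanC; [|exact: flow_down_ge0|exact: flow_up_ge0].
Qed.

Lemma action_state m psi : -1 <= m <= 1 ->
  action T (state m) psi = theta m * (psi 0 1 - psi 0 0) ^+ 2.
Proof.
move=> m1; rewrite /action !sum_ord2 Lambda_state01 Lambda_state10//; by field.
Qed.

Lemma flux_state0 m psi : -1 <= m <= 1 ->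
  ddiv (map2_mx *%R (Lambda T (state m)) (dgrad psi)) 0 0 = theta m * (psi 0 1 - psi 0 0).
Proof.
move=> m1; rewrite mxE sum_ord2 ![map2_mx _ _ _ _ _]mxE Lambda_state01 Lambda_state10//.
by rewrite ![dgrad _ _ _]mxE; field.
Qed.

Lemma flux_state1 m psi : -1 <= m <= 1 ->
  ddiv (map2_mx *%R (Lambda T (state m)) (dgrad psi)) 0 1 = - (theta m * (psi 0 1 - psi 0 0)).
Proof.
move=> m1; rewrite mxE sum_ord2 ![map2_mx _ _ _ _ _]mxE Lambda_state01 Lambda_state10//.
by rewrite ![dgrad _ _ _]mxE; field.
Qed.

Lemma free_energy_state m : free_energy T (state m) = entropy beta m.
Proof.
rewrite /free_energy sum_ord2 /= cw_potential_energyE state0 state1 /entropy; ring.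
Qed.

(** The mobility is handled as a continuous function on ]-1, 1[ extended by its
    boundary value 0. *)
Lemma measurable_mobility_comp (f : R -> R) :
  measurable_fun (`[0, 1]%classic : set R) f ->
  (forall t, 0 <= t <= 1 -> -1 <= f t <= 1) ->
  measurable_fun (`[0, 1]%classic : set R) (fun t => theta (f t)).
Proof.
move=> mf f1.
have mth : measurable_fun (`]-1, 1[%classic : set R) theta.
  apply: open_continuous_measurable_fun => // x.
  by rewrite inE /= in_itv /= => x1; exact: mobility_continuous.
have mth' : measurable_fun [set: R] (theta \_ `]-1, 1[).
  exact/(measurable_restrictT _ _).1.
apply: (eq_measurable_fun (theta \_ `]-1, 1[ \o f)); last exact: measurableT_comp.
move=> t; rewrite inE /= in_itv /= => /f1 ft.
rewrite patchE; case: ifPn => //; rewrite notin_setE /= in_itv /= => /negP h.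
by case: (itvNcc_cases ft) => [->|->|h']; rewrite ?mobilityN1 ?mobility1//; rewrite h' in h.
Qed.

Section curve.
Variables (mu psi : R -> 'rV[R]_2).
Hypothesis ce : CE T mu psi.
Let m t := magnetization (mu t).
Let v t := psi t 0 1 - psi t 0 0.

Let m_itv t : 0 <= t <= 1 -> -1 <= m t <= 1.
Proof. by case: ce => h _ _ _ t01; apply: magnetization_itv; apply: h; rewrite in_itv. Qed.

Let muE t : 0 <= t <= 1 -> mu t = state (m t).
Proof. by case: ce => h _ _ _ t01; rewrite state_magnetization//; apply: h; rewrite in_itv. Qed.

Lemma CE_continuous : {within `[0, 1], continuous m}.
Proof. by case: ce => _ c _ _ t; apply: cvgB; exact: c. Qed.

Let m_meas : measurable_fun (`[0, 1]%classic : set R) m.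
Proof. apply: subspace_continuous_measurable_fun => //; exact: CE_continuous. Qed.

Let th_meas : measurable_fun (`[0, 1]%classic : set R) (fun t => theta (m t)).
Proof. exact: measurable_mobility_comp. Qed.

Let v_int : leb.-integrable `[0, 1] (EFin \o v).
Proof. by case: ce => _ _ i _; exact: (integrableB _ (i 1) (i 0)). Qed.

Let v_meas : measurable_fun (`[0, 1]%classic : set R) v.
Proof. by apply/measurable_EFinP; exact: (measurable_int _ v_int). Qed.

Lemma CE_flux_integrable : leb.-integrable `[0, 1] (EFin \o (fun t => theta (m t) * v t)).
Proof.
apply: (le_integrable _ _ _ v_int) => //.
  by apply/measurable_EFinP/measurable_funM.
move=> t; rewrite /= in_itv /= => /m_itv m1; rewrite lee_fin normrM ler_piMl//.
rewrite ger0_norm ?mobility_ge0//; apply: le_trans (mobility_le_half _ _ m1) _ => //; lra.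
Qed.

Lemma CE_speed_integrable :
  leb.-integrable `[0, 1] (EFin \o (fun t => Num.sqrt (theta (m t)) * `|v t|)).
Proof.
apply: (le_integrable _ _ _ v_int) => //.
  apply/measurable_EFinP/measurable_funM; last exact: measurableT_comp.
  have ms : measurable_fun [set: R] (@Num.sqrt R).
    by apply: continuous_measurable_fun; exact: sqrt_continuous.
  exact: (measurableT_comp ms th_meas).
move=> t; rewrite /= in_itv /= => /m_itv m1; rewrite lee_fin normrM normr_id ler_piMl//.
rewrite ger0_norm ?sqrtr_ge0// -sqrtr1 ler_wsqrtr//.
by apply: le_trans (mobility_le_half _ _ m1) _ => //; lra.
Qed.

(** The increment of the first coordinate, which is half that of the
    magnetization, comes from the continuity equation in state 0. *)
Lemma CE_increment s t : 0 <= s -> s < t -> t <= 1 ->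
  `|m t - m s| <= \int[leb]_(x in `[s, t]) (2 * (theta (m x) * `|v x|)).
Proof.
move=> s0 st t1.
have [hp hc _ hw] := ce.
have jn x : 0 <= x <= 1 -> `|theta (m x) * v x| = theta (m x) * `|v x|.
  by move=> /m_itv m1; rewrite normrM ger0_norm// mobility_ge0.
have H : `|mu t 0 0 - mu s 0 0| <= \int[leb]_(x in `[s, t]) `|theta (m x) * v x|.
  apply: (@weak_derivative_increment _ (fun t => mu t 0 0) (fun x => theta (m x) * v x)) => //.
    exact: CE_flux_integrable.
  move=> phi tphi; rewrite -[RHS](hw phi 0 tphi); congr (_ + _).
  apply: eq_Rintegral => x; rewrite inE /= in_itv /= => x01.
  by rewrite muE// flux_state0 ?m_itv.
have sm x : 0 <= x <= 1 -> mu x 0 0 = (1 + m x) / 2.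
  by move=> x01; rewrite muE// state0.
have s01 : 0 <= s <= 1 by rewrite s0 (le_trans (ltW st)).
have t01 : 0 <= t <= 1 by rewrite t1 (le_trans s0 (ltW st)).
have iJ : leb.-integrable `[s, t] (EFin \o (fun x => `|theta (m x) * v x|)).
  by apply: integrable_subitv => //; exact: (integrable_abse CE_flux_integrable).
have -> : \int[leb]_(x in `[s, t]) (2 * (theta (m x) * `|v x|)) =
   2 * \int[leb]_(x in `[s, t]) `|theta (m x) * v x|.
  rewrite -RintegralZl//; apply: eq_Rintegral => x; rewrite inE /= in_itv /= => /andP[? ?].
  by rewrite jn//; apply/andP; split; lra.
move: H; rewrite !sm//.
have -> : (1 + m t) / 2 - (1 + m s) / 2 = 2^-1 * (m t - m s) by field.
by rewrite normrM ger0_norm ?invr_ge0// ler_pdivrMl.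
Qed.

Lemma CE_energy_ge (w S : R -> R) :
  continuous w -> (forall x, is_derive x 1 S (w x)) ->
  (forall x, -1 <= x <= 1 -> 2 * `|w x| * Num.sqrt (theta x) <= 1) ->
  (`|S (m 1) - S (m 0)|%:E <=
    sqrte (\int[leb]_(t in `[0%R, 1%R]) (action T (mu t) (psi t))%:E))%E.
Proof.
move=> cw dS w1.
have th0 x : 0 <= x <= 1 -> 0 <= theta (m x) by move=> /m_itv; exact: mobility_ge0.
apply: (@length_le_sqrt_energy _ _ (fun t => Num.sqrt (theta (m t)) * `|v t|)) => //.
- apply: (@curve_length_ge _ m (fun x => 2 * (theta (m x) * `|v x|)) _ w S) => //.
  + exact: CE_continuous.
  + suff h : leb.-integrable `[0, 1] (EFin \o (fun x => theta (m x) * `|v x|)).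
      exact: (integrableZl _ 2 h).
    have := integrable_abse CE_flux_integrable; apply: eq_integrable => // x.
    rewrite inE /= in_itv /= => x01; congr (_%:E).
    by rewrite normrM ger0_norm ?th0.
  + exact: CE_speed_integrable.
  + by move=> x x01; apply: mulr_ge0 => //; apply: mulr_ge0 => //; exact: th0.
  + exact: CE_increment.
  + move=> x x01; rewrite -{1}[theta (m x)]sqr_sqrtr ?th0// expr2.
    have := w1 _ (m_itv x01).
    have : 0 <= Num.sqrt (theta (m x)) * `|v x| by rewrite mulr_ge0 ?sqrtr_ge0.
    move=> /ler_wpM2r h /h; rewrite mul1r; apply: le_trans.
    by rewrite le_eqVlt; apply/orP; left; apply/eqP; ring.
- exact: CE_speed_integrable.
- apply: (eq_measurable_fun (fun t => theta (m t) * (v t) ^+ 2)).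
    move=> t; rewrite inE /= in_itv /= => t01.
    by rewrite [in RHS]muE// action_state// m_itv.
  by apply: measurable_funM => //; apply: measurable_funX.
- move=> x x01; rewrite muE// action_state ?m_itv// exprMn sqr_sqrtr ?th0//.
  by rewrite real_normK ?num_real.
Qed.

End curve.

(** Any [S] whose derivative is dominated by the line element 1 / (2 sqrt theta)
    is 1-Lipschitz for W.  Leaving [w] free allows both cut-offs of the singular
    density and a constant density. *)
Lemma W_dist_ge (w S : R -> R) (nu0 nu1 : 'rV[R]_2) :
  continuous w -> (forall x, is_derive x 1 S (w x)) ->
  (forall x, -1 <= x <= 1 -> 2 * `|w x| * Num.sqrt (theta x) <= 1) ->
  (`|S (magnetization nu1) - S (magnetization nu0)|%:E <= W_dist T nu0 nu1)%E.
Proof.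
move=> cw dS w1; apply: le_ereal_inf_tmp => _ [mu [psi [ce <- <- ->]]].
exact: CE_energy_ge.
Qed.

End two_state.

(** * The transport distance as arc length *)

Section metric.
Context {R : realType} (beta : R).
Hypotheses (beta_ge0 : 0 <= beta) (beta_le1 : beta <= 1).
Implicit Types m x y z t : R.
Notation leb := (@lebesgue_measure R).
Notation T := (curie_weiss beta).
Notation theta := (mobility beta).

Definition density x : R := (2 * Num.sqrt (theta x))^-1.

Lemma density_gt0 x : -1 < x < 1 -> 0 < density x.
Proof. by move=> x1; rewrite invr_gt0 mulr_gt0// sqrtr_gt0 mobility_gt0. Qed.

Lemma density_continuous x : -1 < x < 1 -> {for x, continuous density}.
Proof.
move=> x1; apply: continuousV.
  by rewrite mulf_neq0// gt_eqF// sqrtr_gt0 mobility_gt0.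
apply: continuousM; first exact: cst_continuous.
by apply: continuous_comp; [exact: mobility_continuous|exact: sqrt_continuous].
Qed.

(** The density blows up at m = -1 and m = 1.  An arc-length function at level
    [z] has the exact density on [-z, z] and at most that density elsewhere in
    ]-1, 1[; this keeps [S] globally defined and differentiable, and W bounded
    from below by its increments. *)
Record arclength z (w S : R -> R) : Prop := Arclength {
  arclength_continuous : continuous w;
  arclength_derive : forall x, is_derive x 1 S (w x);
  arclength_short : forall x, -1 <= x <= 1 -> 2 * `|w x| * Num.sqrt (theta x) <= 1;
  arclength_eq : forall x, -z <= x <= z -> w x = density x }.

Lemma exists_arclength z : 0 < z < 1 -> exists w S, arclength z w S.
Proof.
move=> /andP[z0 z1].
pose z' := (1 + z) / 2.
have z'z : - z' < - z by rewrite /z'; lra.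
have [eta [chi [_ dchi eta0 _ [chi0 chi1]]]] := smooth_step z'z.
have chi_mono u v : u <= v -> chi u <= chi v.
  move=> uv; apply: (@nondecreasing_is_derive _ chi eta) => // y _.
  exact: is_derive_continuous (dchi y).
have chi_ge0 u : 0 <= chi u.
  have [h|h] := leP u (- z'); first by rewrite chi0.
  by rewrite -(chi0 _ (lexx _)) chi_mono// ltW.
have chi_le1 u : chi u <= 1.
  have [h|h] := leP (- z) u; first by rewrite chi1.
  by rewrite -(chi1 _ (lexx _)) chi_mono// ltW.
pose w x := chi (- `|x|) * density x.
have w0 x : z' <= `|x| -> w x = 0 by move=> h; rewrite /w chi0 ?mul0r ?lerN2.
have cw : continuous w.
  move=> x; have [h|h] := ltP `|x| 1.
    apply: continuousM; last first.
      by apply: density_continuous; rewrite -ltr_norml.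
    apply: (@continuous_comp _ _ _ (fun x : R => - `|x|) chi).
      by apply: continuousN; exact: norm_continuous.
    exact: is_derive_continuous (dchi _).
  have wx0 : w x = 0 by apply: w0; apply: le_trans h; rewrite /z'; lra.
  rewrite /continuous_at wx0; apply: cvg_near_cst.
  near=> y; apply: w0; apply: ltW; near: y.
  apply: (cvgr_gt `|x|); first exact: norm_continuous.
  by apply: lt_le_trans h; rewrite /z'; lra.
exists w, (primitive (- 2) w); split => //.
- move=> x; have [h|h] := ltP (- 2) x; first exact: is_derive_primitive.
  have small y : y <= -1 -> w y = 0.
    move=> y1; apply: w0; rewrite ler0_norm; last by lra.
    by rewrite /z'; lra.
  rewrite small; last by lra.
  apply: (@near_eq_is_derive _ _ _ (cst 0)).
  near=> y; rewrite primitive_eq0// => t ty; apply: small; apply: le_trans ty _.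
  by apply: ltW; near: y; apply: lt_nbhsl; lra.
- move=> x /itvNcc_cases[->|->|x1].
  + by rewrite mobilityN1 sqrtr0 mulr0.
  + by rewrite mobility1 sqrtr0 mulr0.
  rewrite normrM (ger0_norm (chi_ge0 _)) (gtr0_norm (density_gt0 x1)).
  have s0 : 2 * Num.sqrt (theta x) != 0.
    by rewrite mulf_neq0// gt_eqF// sqrtr_gt0 mobility_gt0.
  have -> : 2 * (chi (- `|x|) * density x) * Num.sqrt (theta x) = chi (- `|x|).
    by rewrite /density; field; rewrite gt_eqF// sqrtr_gt0 mobility_gt0.
  exact: chi_le1.
- move=> x; rewrite -ler_norml => xz.
  by rewrite /w chi1 ?mul1r// lerN2.
Unshelve. all: by end_near. Qed.

(** Uses the constant density 1 / sqrt 2, which lies below the line element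
    because the mobility is at most 1/2; boundary states are included. *)
Lemma W_dist_Lipschitz nu0 nu1 :
  ((Num.sqrt (1 / 2) * `|magnetization nu1 - magnetization nu0|)%:E <= W_dist T nu0 nu1)%E.
Proof.
set c := Num.sqrt (1 / 2).
have c0 : 0 <= c by exact: sqrtr_ge0.
have -> : c * `|magnetization nu1 - magnetization nu0| =
   `|c * magnetization nu1 - c * magnetization nu0|.
  by rewrite -mulrBr normrM (ger0_norm c0).
apply: (@W_dist_ge _ _ beta_ge0 beta_le1 (cst c) (fun x => c * x)).
- exact: cst_continuous.
- by move=> x; apply: is_derive_eq; rewrite /GRing.scale /= mulr1.
move=> x x1; rewrite ger0_norm//.
have h : Num.sqrt (theta x) <= c.
  by rewrite ler_wsqrtr// mobility_le_half.
have := ler_wpM2l c0 h; rewrite -expr2 sqr_sqrtr; last by lra.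
by rewrite /= -mulrA; lra.
Qed.

Definition potential_row (p : R) : 'rV[R]_2 := \row_i (if i == 0 then 0 else p).

Section smooth_curve.
Variables (gam q : R -> R).
Hypothesis gam_itv : forall t, 0 <= t <= 1 -> -1 < gam t < 1.
Hypothesis gam_der : forall t, 0 <= t <= 1 -> is_derive t 1 gam (q t).
Hypothesis q_cont : {within `[0, 1], continuous q}.

Let muc t := state (gam t).
Let psic t := potential_row (- (q t / (2 * theta (gam t)))).

Let gam_itv' t : 0 <= t <= 1 -> -1 <= gam t <= 1.
Proof. by move=> /gam_itv /andP[? ?]; rewrite !ltW. Qed.

Let gam_cont : {within `[0, 1], continuous gam}.
Proof.
apply: continuous_in_subspaceT => t; rewrite inE /= in_itv /= => t01.
exact: is_derive_continuous (gam_der t01).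
Qed.

(** With psi_1 - psi_0 = - q / (2 theta) the flux is half the velocity up to sign,
    and the weak equation is an integration by parts. *)
Lemma smooth_curve_CE : CE T muc psic.
Proof.
have th0 t : 0 <= t <= 1 -> theta (gam t) != 0.
  by move=> /gam_itv h; rewrite gt_eqF// mobility_gt0.
split.
- by move=> t; rewrite in_itv /= => /gam_itv'; exact: is_prob_state.
- have hc (a b : R) : {within `[0, 1], continuous (fun t => (a + b * gam t) / 2)}.
    move=> t; apply: cvgM; last exact: cvg_cst.
    by apply: cvgD; [exact: cvg_cst | apply: cvgM; [exact: cvg_cst|exact: gam_cont]].
  apply: ord2P.
    have -> : (fun t => muc t 0 0) = (fun t => (1 + 1 * gam t) / 2).
      by apply/funext => t; rewrite state0 mul1r.
    exact: hc.
  have -> : (fun t => muc t 0 1) = (fun t => (1 + - 1 * gam t) / 2).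
    by apply/funext => t; rewrite state1 mulN1r.
  exact: hc.
- apply: ord2P.
    have -> : (fun t => (psic t 0 0)%:E) = EFin \o cst 0.
      by apply/funext => t; rewrite /= mxE.
    by apply: continuous_itv_integrable; apply: continuous_subspaceT; exact: cst_continuous.
  have -> : (fun t => (psic t 0 1)%:E) = EFin \o (fun t => - (q t / (2 * theta (gam t)))).
    by apply/funext => t; rewrite /= mxE.
  apply: continuous_itv_integrable.
  have cden : {within `[0, 1], continuous (fun t => 2 * theta (gam t))}.
    apply: continuous_in_subspaceT => t; rewrite inE /= in_itv /= => t01.
    apply: cvgM; first exact: cvg_cst.
    apply: continuous_comp; first exact: is_derive_continuous (gam_der t01).
    exact: (mobility_continuous beta_ge0 beta_le1 (gam_itv t01)).
  apply/subspace_continuousP => t t01.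
  have t01' : 0 <= t <= 1 by rewrite /= in_itv /= in t01.
  apply: cvgN; apply: cvgM.
    by move/subspace_continuousP: q_cont; exact.
  apply: cvgV; first by rewrite mulf_neq0// th0.
  by move/subspace_continuousP: cden; exact.
move=> phi x tphi.
have [sphi _] := tphi.
have : forall i : 'I_2, exists2 s : R,
    (forall t, 0 <= t <= 1 ->
       ddiv (map2_mx *%R (Lambda T (muc t)) (dgrad (psic t))) 0 i = - (s * q t / 2)) &
    (forall t, muc t 0 i = (1 + s * gam t) / 2).
  apply: ord2P.
    exists 1; last by move=> t; rewrite state0 mul1r.
    move=> t t01; rewrite flux_state0 ?gam_itv'//.
    by rewrite !mxE /= subr0; field; exact: th0.
  exists (- 1); last by move=> t; rewrite state1 mulN1r.
  move=> t t01; rewrite flux_state1 ?gam_itv'//.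
  by rewrite !mxE /= subr0; field; exact: th0.
move=> /(_ x) [s flux mux].
have cphi : continuous phi by exact: smooth_continuous sphi.
have cdphi : continuous (derive1 phi).
  by apply: smooth_continuous; exact: smooth_derive1 sphi.
pose f1 t := derive1 phi t * ((1 + s * gam t) / 2).
pose f2 t := phi t * - (s * q t / 2).
have cmu : {within `[0, 1], continuous (fun t => (1 + s * gam t) / 2)}.
  move=> t; apply: cvgM; last exact: cvg_cst.
  by apply: cvgD; [exact: cvg_cst | apply: cvgM; [exact: cvg_cst|exact: gam_cont]].
have cf1 : {within `[0, 1], continuous f1}.
  move=> t; apply: cvgM; last exact: cmu.
  exact: continuous_subspaceT.
have cf2 : {within `[0, 1], continuous f2}.
  move=> t; apply: cvgM; first exact: continuous_subspaceT.
  apply: cvgN; apply: cvgM; last exact: cvg_cst.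
  by apply: cvgM; [exact: cvg_cst|exact: q_cont].
have cf : {within `[0, 1], continuous (fun t => f1 t - f2 t)}.
  by move=> t; apply: cvgB; [exact: cf1|exact: cf2].
have dF t : 0 <= t <= 1 ->
    is_derive t 1 (fun t => phi t * ((1 + s * gam t) / 2)) (f1 t - f2 t).
  move=> t01; have d1 := smooth_is_derive t sphi; have d2 := gam_der t01.
  by apply: is_derive_eq; rewrite /GRing.scale /= /f1 /f2; field.
have := Rintegral_is_derive_itv ler01 cf dF.
rewrite !(test_function_0 tphi) ?lexx ?orbT// !mul0r subrr.
rewrite RintegralB//; [|exact: continuous_itv_integrable..].
have -> : \int[leb]_(t in `[0, 1]) (derive1 phi t * muc t 0 x) = \int[leb]_(t in `[0, 1]) f1 t.
  by apply: eq_Rintegral => t _; rewrite mux.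
have -> : \int[leb]_(t in `[0, 1]) (phi t *
    ddiv (map2_mx *%R (Lambda T (muc t)) (dgrad (psic t))) 0 x) = \int[leb]_(t in `[0, 1]) f2 t.
  by apply: eq_Rintegral => t; rewrite inE /= in_itv /= => t01; rewrite flux.
by move: (Rintegral _ _ _) (Rintegral _ _ _) => I1 I2 /subr0_eq ->; rewrite addNr.
Qed.

Lemma smooth_curve_action t : 0 <= t <= 1 ->
  action T (muc t) (psic t) = q t ^+ 2 / (4 * theta (gam t)).
Proof.
move=> t01; rewrite action_state ?gam_itv'// !mxE /= subr0.
by field; rewrite gt_eqF// mobility_gt0// gam_itv.
Qed.

Lemma W_dist_le_smooth_curve (c : R) :
  (forall t, 0 <= t <= 1 -> q t ^+ 2 / (4 * theta (gam t)) = c ^+ 2) ->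
  (W_dist T (state (gam 0)) (state (gam 1)) <= `|c|%:E)%E.
Proof.
move=> qc; apply: ge_ereal_inf; eexists.
  by exists muc, psic; split; first exact: smooth_curve_CE.
rewrite (@eq_integral _ _ _ leb _ (cst (c ^+ 2)%:E)); last first.
  by move=> t; rewrite inE /= in_itv /= => t01; rewrite smooth_curve_action// qc.
rewrite integral_cst//= lebesgue_measure_itv /= lte_fin ltr01 oppr0 adde0 mule1.
by rewrite -[sqrte _]/((Num.sqrt (c ^+ 2))%:E) sqrtr_sqr.
Qed.

End smooth_curve.

Section geodesics.
Variables (z : R) (w S : R -> R).
Hypotheses (z01 : 0 < z < 1) (wS : arclength z w S).

Let z_itv x : -z <= x <= z -> -1 < x < 1.
Proof. by move: z01 => /andP[? ?] /andP[? ?]; apply/andP; split; lra. Qed.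

Let S_lt x y : -z <= x -> x < y -> y <= z -> S x < S y.
Proof.
move=> zx xy yz.
have cS : {within `[x, y], continuous S}.
  by apply: continuous_subspaceT => t; exact: is_derive_continuous (arclength_derive wS t).
have [c] := MVT xy (fun t _ => arclength_derive wS t) cS.
rewrite in_itv /= => /andP[xc cy] E; rewrite -subr_gt0 E mulr_gt0 ?subr_gt0//.
have cz : -z <= c <= z by apply/andP; split; lra.
by rewrite (arclength_eq wS)// density_gt0// z_itv.
Qed.

Lemma arclength_inj x y : -z <= x <= z -> -z <= y <= z -> S x = S y -> x = y.
Proof.
move=> /andP[? ?] /andP[? ?] E; have [xy|xy|//] := ltgtP x y.
  by have : S x < S y; [exact: S_lt | rewrite E ltxx].
by have : S y < S x; [exact: S_lt | rewrite E ltxx].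
Qed.

(** The geodesic is the inverse of [S] applied to an affine function of time. *)
Lemma exists_geodesic x y : -z < x < z -> -z < y < z ->
  exists gam : R -> R, [/\ gam 0 = x, gam 1 = y,
    forall t, 0 <= t <= 1 -> -z < gam t < z,
    forall t, 0 <= t <= 1 -> S (gam t) = S x + t * (S y - S x) &
    forall t, 0 <= t <= 1 ->
      is_derive t 1 gam ((S y - S x) * (2 * Num.sqrt (theta (gam t))))].
Proof.
move=> xz yz.
have cS t : {for t, continuous S}.
  exact: is_derive_continuous (arclength_derive wS t).
pose g (u : R) : R := xget 0 [set p | -z < p < z /\ S p = u].
have gK p : -z < p < z -> g (S p) = p.
  move=> pz; rewrite /g; case: xgetP => [p' _ [p'z E]|/(_ p) []//].
  by apply: arclength_inj => //; [move: p'z|move: pz] => /andP[? ?]; rewrite !ltW.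
have ivt u : Num.min (S x) (S y) <= u <= Num.max (S x) (S y) ->
    exists2 p, -z < p < z & S p = u.
  have cS' a b : {within `[a, b], continuous S} by exact: continuous_subspaceT.
  move: xz yz => /andP[? ?] /andP[? ?] uS; have [xy|yx] := leP x y.
    have [p] := IVT xy (cS' _ _) uS.
    by rewrite in_itv /= => /andP[? ?] ?; exists p => //; apply/andP; split; lra.
  rewrite minC maxC in uS; have [p] := IVT (ltW yx) (cS' _ _) uS.
  by rewrite in_itv /= => /andP[? ?] ?; exists p => //; apply/andP; split; lra.
pose c := S y - S x.
have hit t : 0 <= t <= 1 -> exists2 p, -z < p < z & S p = S x + t * c.
  move=> /andP[t0 t1]; apply: ivt; rewrite /c ge_min le_max.
  have [h|h] := leP (S x) (S y).
    have h' : 0 <= S y - S x by rewrite subr_ge0.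
    have := mulr_ge0 t0 h'; have := ler_piMl h' t1 => ? ?.
    by apply/andP; split; apply/orP; [left|right]; lra.
  have h' : 0 <= S x - S y by rewrite subr_ge0 ltW.
  have := mulr_ge0 t0 h'; have := ler_piMl h' t1 => ? ?.
  by apply/andP; split; apply/orP; [right|left]; lra.
exists (fun t => g (S x + t * c)); split.
- by rewrite mul0r addr0 gK.
- by rewrite mul1r /c addrC subrK gK.
- by move=> t /hit[p pz <-]; rewrite gK.
- by move=> t /hit[p pz <-]; rewrite gK.
move=> t /hit[p pz E].
have pz' : -z <= p <= z by move: pz => /andP[? ?]; rewrite !ltW.
have dS : is_derive p 1 S (density p).
  by rewrite -(arclength_eq wS pz'); exact: arclength_derive wS p.
have dg : is_derive (S p) 1 g (density p)^-1.
  apply: is_derive_inverse => //.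
  - move: pz => /andP[? ?]; near=> r; apply: gK; apply/andP; split; near: r.
      exact: lt_nbhsr.
    exact: lt_nbhsl.
  - by near=> r; exact: cS.
  - by rewrite gt_eqF// density_gt0// z_itv.
rewrite E in dg.
have da : is_derive t 1 (fun t => S x + t * c) c.
  by apply: is_derive_eq; rewrite /GRing.scale /=; ring.
have := @is_derive1_comp _ g (fun t => S x + t * c) t _ _ dg da.
rewrite -E gK// /density invrK mulrC.
exact.
Unshelve. all: by end_near. Qed.

(** The curve of [exists_geodesic] has constant action (S y - S x)^2, which
    attains the lower bound. *)
Lemma W_dist_arclength x y : -z < x < z -> -z < y < z ->
  W_dist T (state x) (state y) = `|S y - S x|%:E.
Proof.
move=> xz yz; apply/le_anti/andP; split; last first.
  rewrite -{1}[x](magnetization_state) -{1}[y](magnetization_state).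
  exact: (W_dist_ge beta_ge0 beta_le1 _ _ (arclength_continuous wS)
    (arclength_derive wS) (arclength_short wS)).
have [gam [<- <- gz Sg dg]] := exists_geodesic xz yz.
have g1 t : 0 <= t <= 1 -> -1 < gam t < 1.
  by move=> /gz /andP[? ?]; apply: z_itv; rewrite !ltW.
set c := S (gam 1) - S (gam 0) in dg *.
apply: (W_dist_le_smooth_curve g1 dg).
  apply: continuous_in_subspaceT => t; rewrite inE /= in_itv /= => t01.
  apply: cvgM; first exact: cvg_cst.
  apply: cvgM; first exact: cvg_cst.
  apply: (@continuous_comp _ _ _ (fun t => theta (gam t)) Num.sqrt);
    last exact: sqrt_continuous.
  apply: continuous_comp; first exact: is_derive_continuous (dg _ t01).
  exact: (mobility_continuous beta_ge0 beta_le1 (g1 _ t01)).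
move=> t t01; have th0 := mobility_gt0 beta (g1 _ t01).
rewrite !exprMn sqr_sqrtr ?(ltW th0)//; field.
by rewrite gt_eqF.
Qed.

End geodesics.
End metric.

(** * Convexity of the free energy along arc length *)

Section convexity.
Context {R : realType} (beta : R).
Hypotheses (beta_ge0 : 0 <= beta) (beta_le1 : beta <= 1).
Implicit Types m x y z t : R.
Notation T := (curie_weiss beta).
Notation theta := (mobility beta).
Notation kappa0 := (2 * (1 - beta)).

Section along_arclength.
Variables (z : R) (w S : R -> R).
Hypotheses (z01 : 0 < z < 1) (wS : arclength beta z w S).

Let z_itv x : -z <= x <= z -> -1 < x < 1.
Proof. by move: z01 => /andP[? ?] /andP[? ?]; apply/andP; split; lra. Qed.

Let S_cont x : {for x, continuous S}.
Proof. exact: is_derive_continuous (arclength_derive wS x). Qed.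

(** The slope is differentiated away from 0, so an interval containing 0 is cut
    there. *)
Lemma slope_increment x y : -z <= x -> x <= y -> y <= z ->
  kappa0 * (S y - S x) <= slope beta y - slope beta x.
Proof.
have side a b : -z <= a -> a <= b -> b <= z -> (0 <= a) || (b <= 0) ->
    kappa0 * (S b - S a) <= slope beta b - slope beta a.
  move=> za ab bz ab0.
  have abz t : a <= t <= b -> -z <= t <= z by move=> /andP[? ?]; apply/andP; split; lra.
  pose D t := (flow_diff1 beta t + 2 * theta t * entropy2 beta t) / (2 * Num.sqrt (theta t))
    - kappa0 * w t.
  suff : slope beta a - kappa0 * S a <= slope beta b - kappa0 * S b by lra.
  apply: (@nondecreasing_is_derive _ (fun t => slope beta t - kappa0 * S t) D) => //.
  - move=> t /andP[ta tb]; have tz : -z <= t <= z by apply: abz; rewrite !ltW.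
    have t0 : t != 0.
      by case/orP: ab0 => h; [rewrite gt_eqF//; lra | rewrite lt_eqF//; lra].
    have d1 := is_derive_slope beta_le1 (z_itv tz) t0.
    have d2 := arclength_derive wS t.
    by apply: is_derive_eq.
  - move=> t /abz /z_itv t1; apply: continuousB.
      exact: (slope_continuous beta_ge0 beta_le1 t1).
    by apply: continuousM; [exact: cst_continuous|exact: S_cont].
  - move=> t /andP[ta tb]; have tz : -z <= t <= z by apply: abz; rewrite !ltW.
    rewrite /D (arclength_eq wS tz) /density -mulrBl; apply: mulr_ge0.
      by rewrite subr_ge0 slope_der_ge// z_itv.
    by rewrite invr_ge0; apply: mulr_ge0 => //; exact: sqrtr_ge0.
move=> zx xy yz; have [x0|x0] := leP 0 x; first by apply: side => //; rewrite x0.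
have [y0|y0] := leP y 0; first by apply: side => //; rewrite y0 orbT.
have /andP[z0 _] := z01.
have h1 : kappa0 * (S 0 - S x) <= slope beta 0 - slope beta x.
  by apply: side; rewrite ?lexx ?orbT// ltW.
have h2 : kappa0 * (S y - S 0) <= slope beta y - slope beta 0.
  by apply: side; rewrite ?lexx// ?oppr_le0 ltW.
have := lerD h1 h2; rewrite -mulrDr.
have -> : S 0 - S x + (S y - S 0) = S y - S x by ring.
by have -> : slope beta 0 - slope beta x + (slope beta y - slope beta 0) =
  slope beta y - slope beta x by ring.
Qed.

Lemma entropy1_slope x : -z <= x <= z -> entropy1 beta x = w x * slope beta x.
Proof.
move=> xz; rewrite (arclength_eq wS xz) /density /slope; field.
by rewrite gt_eqF// sqrtr_gt0 mobility_gt0// z_itv.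
Qed.

(** The free energy lies above its tangent parabola in the arc-length coordinate.
    The derivative of the difference of the two sides is [w] times
    slope x - slope y - kappa (S x - S y), whose sign is that of x - y. *)
Lemma entropy_tangent x y : -z <= x <= z -> -z <= y <= z ->
  entropy beta y + slope beta y * (S x - S y) + kappa0 / 2 * (S x - S y) ^+ 2
  <= entropy beta x.
Proof.
move=> xz yz.
pose H t := entropy beta t - slope beta y * (S t - S y)
  - kappa0 / 2 * ((S t - S y) * (S t - S y)).
pose H1 t := w t * (slope beta t - slope beta y - kappa0 * (S t - S y)).
have dH t : -z <= t <= z -> is_derive t 1 H (H1 t).
  move=> tz; have d1 := is_derive_entropy beta (z_itv tz).
  have d2 := arclength_derive wS t.
  by apply: is_derive_eq; rewrite /GRing.scale /= /H1 entropy1_slope//; field.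
have cH t : -z <= t <= z -> {for t, continuous H}.
  by move=> tz; exact: is_derive_continuous (dH t tz).
have w0 t : -z <= t <= z -> 0 <= w t.
  by move=> tz; rewrite (arclength_eq wS tz) ltW// density_gt0// z_itv.
have HY : H y = entropy beta y by rewrite /H subrr !mulr0 !subr0.
suff : H y <= H x by rewrite HY /H expr2; lra.
move: xz yz => /andP[zx xz] /andP[zy yz].
have [yx|xy] := leP y x.
  apply: (@nondecreasing_is_derive _ H H1) => //.
  - by move=> t /andP[? ?]; apply: dH; apply/andP; split; lra.
  - by move=> t /andP[? ?]; apply: cH; apply/andP; split; lra.
  - move=> t /andP[? ?]; apply: mulr_ge0; first by apply: w0; apply/andP; split; lra.
    have h := @slope_increment y t zy ltac:(lra) ltac:(lra); lra.
rewrite -lerN2.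
apply: (@nondecreasing_is_derive _ (fun t => - H t) (fun t => - H1 t) x y (ltW xy)).
- move=> t /andP[? ?].
  have d : is_derive t 1 H (H1 t) by apply: dH; apply/andP; split; lra.
  exact: is_derive_eq.
- move=> t /andP[? ?]; apply: continuousN.
  by apply: cH; apply/andP; split; lra.
- move=> t /andP[? ?]; rewrite /H1 -mulrN; apply: mulr_ge0.
    by apply: w0; apply/andP; split; lra.
  have h := @slope_increment t y ltac:(lra) ltac:(lra) yz; lra.
Qed.

(** Convex combination of the tangent inequalities at [y] evaluated at [x]
    and [p]. *)
Lemma entropy_convex x y p t : 0 <= t <= 1 ->
  -z <= x <= z -> -z <= y <= z -> -z <= p <= z ->
  S y = (1 - t) * S x + t * S p ->
  entropy beta y <= (1 - t) * entropy beta x + t * entropy beta p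
    - kappa0 / 2 * t * (1 - t) * (S p - S x) ^+ 2.
Proof.
move=> /andP[t0 t1] xz yz pz Sy.
have t1' : 0 <= 1 - t by rewrite subr_ge0.
have h1 := ler_wpM2l t1' (entropy_tangent xz yz).
have h2 := ler_wpM2l t0 (entropy_tangent pz yz).
apply: le_trans (lerB (lerD h1 h2) (lexx _)).
by rewrite le_eqVlt; apply/orP; left; apply/eqP; rewrite Sy; field.
Qed.

End along_arclength.

Lemma entropy_continuous : continuous (entropy beta).
Proof.
move=> x.
have c1 (s : R) : (1 + s * y) / 2 @[y --> x] --> (1 + s * x) / 2.
  apply: cvgM; last exact: cvg_cst.
  by apply: cvgD; [exact: cvg_cst|apply: cvgM; [exact: cvg_cst|exact: cvg_id]].
have c2 (s : R) : {for x, continuous (fun y => (1 + s * y) / 2 * ln ((1 + s * y) / 2))}.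
  by apply: (@continuous_comp _ _ _ (fun y => (1 + s * y) / 2) (fun y => y * ln y));
    [exact: c1|exact: xlnx_continuous].
have -> : entropy beta = (fun y =>
   (1 + 1 * y) / 2 * ln ((1 + 1 * y) / 2) + (1 + -1 * y) / 2 * ln ((1 + -1 * y) / 2) +
   2 * beta * ((1 + 1 * y) / 2) * ((1 + -1 * y) / 2)).
  by apply/funext => y; rewrite /entropy mul1r mulN1r.
apply: cvgD; first by apply: cvgD; exact: c2.
apply: cvgM; last exact: c1.
by apply: cvgM; [exact: cvg_cst|exact: c1].
Qed.

End convexity.

(** * Geodesics and the optimal curvature constant *)

Section curvature.
Context {R : realType} (beta : R).
Hypotheses (beta_ge0 : 0 <= beta) (beta_le1 : beta <= 1).
Implicit Types m x y z s t : R.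
Notation T := (curie_weiss beta).
Notation kappa0 := (2 * (1 - beta)).

Lemma exists_arclength_around x y p : -1 < x < 1 -> -1 < y < 1 -> -1 < p < 1 ->
  exists z w S, [/\ 0 < z < 1, arclength beta z w S,
    -z < x < z, -z < y < z & -z < p < z].
Proof.
rewrite -!ltr_norml => hx hy hp.
pose M := Num.max `|x| (Num.max `|y| `|p|); pose z := (1 + M) / 2.
have h1 : M < 1 by rewrite !gt_max hx hy hp.
have h2 : `|x| <= M by rewrite le_max lexx.
have h3 : `|y| <= M by rewrite !le_max lexx orbT.
have h4 : `|p| <= M by rewrite !le_max lexx !orbT.
have h5 := normr_ge0 x.
have z01 : 0 < z < 1 by rewrite /z; apply/andP; split; lra.
have [w [S wS]] := exists_arclength beta_ge0 beta_le1 z01.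
by exists z, w, S; split => //; rewrite -ltr_norml /z; lra.
Qed.

Lemma W_dist_interior_fin x y : -1 < x < 1 -> -1 < y < 1 ->
  W_dist T (state x) (state y) \is a fin_num.
Proof.
move=> x1 y1; have [z [w [S [z01 wS xz yz _]]]] := exists_arclength_around x1 y1 y1.
by rewrite (W_dist_arclength beta_ge0 beta_le1 z01 wS xz yz).
Qed.

Lemma W_dist_ge0 (nu0 nu1 : 'rV[R]_2) : (0 <= W_dist T nu0 nu1)%E.
Proof.
apply: le_trans (W_dist_Lipschitz beta_ge0 beta_le1 nu0 nu1).
by rewrite lee_fin mulr_ge0 ?sqrtr_ge0.
Qed.

Section geodesic.
Variable mu : R -> 'rV[R]_2.
Hypothesis geo : geodesic T mu.
Let m t := magnetization (mu t).
Let W01 := W_dist T (mu 0) (mu 1).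

Let muE t : 0 <= t <= 1 -> mu t = state (m t).
Proof. by move=> t01; rewrite state_magnetization//; apply: geo.1; rewrite in_itv. Qed.

Let m_itv t : 0 <= t <= 1 -> -1 <= m t <= 1.
Proof. by move=> t01; apply: magnetization_itv; apply: geo.1; rewrite in_itv. Qed.

Let W_mu s t : 0 <= s <= 1 -> 0 <= t <= 1 ->
  W_dist T (mu s) (mu t) = (`|s - t|%:E * W01)%E.
Proof. by move=> s01 t01; apply: geo.2; rewrite in_itv. Qed.

(** When W01 is nonzero a geodesic is injective, so it visits each of the two
    boundary points at most once. *)
Lemma geodesic_boundary_times : W01 != 0%E -> exists s1 s2 : R, forall s,
  0 <= s <= 1 -> s != s1 -> s != s2 -> -1 < m s < 1.
Proof.
move=> W0.
have inj s t : 0 <= s <= 1 -> 0 <= t <= 1 -> m s = m t -> s = t.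
  move=> s01 t01 E; have := W_mu s01 t01.
  have -> : mu s = mu t by rewrite !muE// E.
  rewrite W_mu// subrr normr0 mul0e => /esym/eqP; rewrite mule_eq0 (negbTE W0) orbF.
  by rewrite eqe normr_eq0 subr_eq0 => /eqP.
exists (xget 0 [set s | 0 <= s <= 1 /\ m s = 1]).
exists (xget 0 [set s | 0 <= s <= 1 /\ m s = -1]).
move=> s s01 n1 n2; case: (itvNcc_cases (m_itv s01)) => // E; exfalso.
  case: xgetP n2 => [s' _ [s'01 E']|/(_ s)[]//].
  by rewrite (inj s s')// ?eqxx// E E'.
case: xgetP n1 => [s' _ [s'01 E']|/(_ s)[]//].
by rewrite (inj s s')// ?eqxx// E E'.
Qed.

Lemma geodesic_eventually_interior (f : R -> R) (b : R) : W01 != 0%E ->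
  f e @[e --> 0^'+] --> b -> (\forall e \near 0^'+, f e != b) ->
  (\forall e \near 0^'+, 0 <= f e <= 1) ->
  \forall e \near 0^'+, -1 < m (f e) < 1.
Proof.
move=> W0 cf f0 f01; have [s1 [s2 H]] := geodesic_boundary_times W0.
near=> e; apply: H.
- by near: e.
- by near: e; apply: near0_right_neq cf f0.
- by near: e; apply: near0_right_neq cf f0.
Unshelve. all: by end_near. Qed.

(** An infinite distance between the end points would be inherited by every pair
    of distinct times, yet two such times give interior states, at finite
    distance. *)
Lemma geodesic_W_fin : W01 \is a fin_num.
Proof.
have [->//|W0] := eqVneq W01 0%E.
have H1 : \forall e \near (0 : R)^'+, -1 < m e < 1.
  apply: (@geodesic_eventually_interior id 0) => //.
  - exact: cvg_at_right_filter cvg_id.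
  - by near=> e; rewrite gt_eqF.
  - near=> e; apply/andP; split; first exact: ltW.
    by near: e; exact: nbhs_right_le.
have H2 : \forall e \near (0 : R)^'+, -1 < m (1 - e) < 1.
  apply: (@geodesic_eventually_interior (fun e => 1 - e) (1 - 0)) => //.
  - apply: cvg_at_right_filter.
    by apply: cvgB; [exact: cvg_cst|exact: cvg_id].
  - by near=> e; have e0 : 0 < e by []; rewrite lt_eqF//; lra.
  - near=> e; have e0 : 0 < e by [].
    have e1 : e < 1 by near: e; exact: nbhs_right_lt.
    by apply/andP; split; lra.
near (0 : R)^'+ => e.
have e0 : 0 < e by [].
have e1 : e < 1 / 3 by near: e; apply: nbhs_right_lt; lra.
have h1 : -1 < m e < 1 by near: e; exact: H1.
have h2 : -1 < m (1 - e) < 1 by near: e; exact: H2.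
have e01 : 0 <= e <= 1 by apply/andP; split; lra.
have e01' : 0 <= 1 - e <= 1 by apply/andP; split; lra.
have := W_dist_interior_fin h1 h2; rewrite -!muE// W_mu//.
have : 0 < `|e - (1 - e)| by rewrite normr_gt0; lra.
have W0' : (0 <= W01)%E by exact: W_dist_ge0.
case: W01 W0' => [//| |]; last by rewrite leeNy_eq.
move=> _ h.
rewrite mulry gtr0_sg// mul1e; exact: id.
Unshelve. all: by end_near. Qed.

Lemma geodesic_Lipschitz (c : R) s t : W01 = c%:E -> 0 <= s <= 1 -> 0 <= t <= 1 ->
  Num.sqrt (1 / 2) * `|m t - m s| <= `|t - s| * c.
Proof.
move=> Wc s01 t01; have := W_dist_Lipschitz beta_ge0 beta_le1 (mu s) (mu t).
by rewrite W_mu// Wc -EFinM lee_fin (distrC s).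
Qed.

Lemma geodesic_entropy_cvg (c : R) (f : R -> R) (t : R) : W01 = c%:E -> 0 <= t <= 1 ->
  f e @[e --> 0^'+] --> t -> (\forall e \near 0^'+, 0 <= f e <= 1) ->
  entropy beta (m (f e)) @[e --> 0^'+] --> entropy beta (m t).
Proof.
move=> Wc t01 ft f01.
apply: (@cvg_comp _ _ _ (fun e => m (f e)) (entropy beta) _ (nbhs (m t))); last first.
  exact: entropy_continuous.
have k0 : 0 < Num.sqrt (1 / 2 : R) by rewrite sqrtr_gt0; lra.
have [c0 cE] : 0 <= c /\ W01 = c%:E.
  by split=> //; have := W_dist_ge0 (mu 0) (mu 1); rewrite -/W01 Wc lee_fin.
apply/cvgrPdist_le => d d0.
have dk : 0 < d * Num.sqrt (1 / 2) / (c + 1) by rewrite !divr_gt0 ?mulr_gt0//; lra.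
have /cvgrPdist_le /(_ _ dk) H := ft.
near=> e.
have fe : 0 <= f e <= 1 by near: e.
have h : `|t - f e| <= d * Num.sqrt (1 / 2) / (c + 1) by near: e; exact: H.
rewrite -(ler_pM2l k0); apply: le_trans (geodesic_Lipschitz Wc fe t01) _.
have c1 : 0 < c + 1 by lra.
rewrite ler_pdivlMr// in h; rewrite [leRHS]mulrC; apply: le_trans h.
by rewrite ler_wpM2l//; lra.
Unshelve. all: by end_near. Qed.

(** Between interior states W is the arc-length distance, so the distances along
    the geodesic place the middle point at the barycentre in arc length. *)
Lemma geodesic_convex_interior (c s u t : R) : W01 = c%:E -> 0 <= c ->
  0 <= t <= 1 -> 0 <= s -> s <= u -> u <= 1 ->
  let r := (1 - t) * s + t * u in
  -1 < m s < 1 -> -1 < m r < 1 -> -1 < m u < 1 ->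
  entropy beta (m r) <= (1 - t) * entropy beta (m s) + t * entropy beta (m u)
    - kappa0 / 2 * t * (1 - t) * ((u - s) * c) ^+ 2.
Proof.
move=> Wc c0 /andP[t0 t1] s0 su u1 r ms mr mu'.
have t1' : 0 <= 1 - t by rewrite subr_ge0.
have us : 0 <= u - s by rewrite subr_ge0.
have rs : r - s = t * (u - s) by rewrite /r; ring.
have ur : u - r = (1 - t) * (u - s) by rewrite /r; ring.
have s01 : 0 <= s <= 1 by rewrite s0 (le_trans su).
have u01 : 0 <= u <= 1 by rewrite u1 (le_trans s0).
have r01 : 0 <= r <= 1.
  have := mulr_ge0 t0 us; rewrite -rs; have := mulr_ge0 t1' us; rewrite -ur => ? ?.
  by apply/andP; split; lra.
have [z [w [S [z01 wS msz mrz muz]]]] := exists_arclength_around ms mr mu'.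
have dS a b : 0 <= a <= 1 -> 0 <= b <= 1 -> -z < m a < z -> -z < m b < z ->
    `|S (m b) - S (m a)| = `|b - a| * c.
  move=> a01 b01 az bz; apply: EFin_inj.
  rewrite -(W_dist_arclength beta_ge0 beta_le1 z01 wS az bz) -!muE// W_mu//.
  by rewrite Wc -EFinM (distrC a).
have d1 := dS _ _ s01 r01 msz mrz; have d2 := dS _ _ r01 u01 mrz muz.
have d3 := dS _ _ s01 u01 msz muz.
rewrite rs (ger0_norm (mulr_ge0 t0 us)) in d1.
rewrite ur (ger0_norm (mulr_ge0 t1' us)) in d2.
rewrite (ger0_norm us) in d3.
have Sr : S (m r) = (1 - t) * S (m s) + t * S (m u).
  have [E|uc0] := eqVneq ((u - s) * c) 0.
    move: d1 d3; rewrite -mulrA E mulr0 => /normr0_eq0/subr0_eq -> /normr0_eq0/subr0_eq ->.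
    ring.
  have := collinear_distances (mulr_ge0 (mulr_ge0 t0 us) c0)
    (mulr_ge0 (mulr_ge0 t1' us) c0) d1 d2.
  have -> : t * (u - s) * c + (1 - t) * (u - s) * c = (u - s) * c by ring.
  move=> /(_ d3) H; apply: (mulfI uc0); rewrite H; ring.
have wk x : -z < x < z -> -z <= x <= z by move=> /andP[? ?]; rewrite !ltW.
have := entropy_convex beta_ge0 beta_le1 z01 wS _ (wk _ msz) (wk _ mrz) (wk _ muz) Sr.
rewrite t0 t1 => /(_ isT) H; apply: le_trans H _.
rewrite le_eqVlt; apply/orP; left; apply/eqP.
by rewrite -d3 real_normK// num_real.
Qed.

(** The interior inequality is applied at the times e, 1 - e^2 and their
    barycentre with weights 1 - t and t.  The unequal speeds make this
    barycentre differ from t for small e > 0, so t itself may be a time at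
    which the geodesic is on the boundary. *)
Lemma geodesic_convex (c t : R) : W01 = c%:E -> 0 <= c -> 0 <= t <= 1 ->
  entropy beta (m t) <= (1 - t) * entropy beta (m 0) + t * entropy beta (m 1)
    - kappa0 / 2 * t * (1 - t) * c ^+ 2.
Proof.
move=> Wc c0 /andP[t0 t1].
have t01 : 0 <= t <= 1 by rewrite t0.
have z01 : 0 <= (0 : R) <= 1 by rewrite lexx ler01.
have o01 : 0 <= (1 : R) <= 1 by rewrite lexx ler01.
move: (t0); rewrite le_eqVlt => /predU1P[<-|tgt0].
  by rewrite subr0 !mulr0 !mul0r mul1r addr0 subr0.
move: (t1); rewrite le_eqVlt => /predU1P[->|tlt1].
  by rewrite subrr !mulr0 !mul0r mul1r add0r subr0.
have [c00|cN0] := eqVneq c 0.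
  have k0 : 0 < Num.sqrt (1 / 2 : R) by rewrite sqrtr_gt0; lra.
  have mconst s : 0 <= s <= 1 -> m s = m 0.
    move=> s01; have := geodesic_Lipschitz Wc z01 s01.
    rewrite c00 mulr0 pmulr_rle0// normr_le0 subr_eq0 => /eqP //.
  rewrite (mconst t)// (mconst 1)// c00 expr0n /= mulr0 subr0 -mulrDl subrK mul1r //.
have W0 : W01 != 0%E by rewrite Wc eqe.
pose s (e : R) := e; pose u (e : R) := 1 - e * e.
pose r (e : R) := (1 - t) * s e + t * u e.
have cs : s e @[e --> (0 : R)^'+] --> (0 : R) by exact: cvg_at_right_filter cvg_id.
have cu : u e @[e --> (0 : R)^'+] --> (1 : R).
  rewrite -[X in _ --> X]subr0 -[X in _ - X](mulr0 (0 : R)).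
  apply: cvg_at_right_filter; apply: cvgB; first exact: cvg_cst.
  by apply: cvgM; exact: cvg_id.
have cr : r e @[e --> (0 : R)^'+] --> t.
  have -> : t = (1 - t) * 0 + t * 1 by rewrite mulr0 add0r mulr1.
  by apply: cvgD; apply: cvgM => //; exact: cvg_cst.
have s01 : \forall e \near (0 : R)^'+, 0 <= s e <= 1.
  near=> e; have e0 : 0 < e by [].
  have e1 : e < 1 by near: e; exact: nbhs_right_lt.
  by rewrite /s !ltW.
have u01 : \forall e \near (0 : R)^'+, 0 <= u e <= 1.
  near=> e; have e0 : 0 < e by [].
  have e1 : e < 1 by near: e; exact: nbhs_right_lt.
  by rewrite /u; apply/andP; split; nra.
have r01 : \forall e \near (0 : R)^'+, 0 <= r e <= 1.
  near=> e; have : 0 <= s e <= 1 by near: e. have : 0 <= u e <= 1 by near: e.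
  by rewrite /r => /andP[? ?] /andP[? ?]; apply/andP; split; nra.
have ms : \forall e \near (0 : R)^'+, -1 < m (s e) < 1.
  apply: (geodesic_eventually_interior W0 cs) => //.
  by near=> e; rewrite /s gt_eqF.
have mu' : \forall e \near (0 : R)^'+, -1 < m (u e) < 1.
  apply: (geodesic_eventually_interior W0 cu) => //.
  near=> e; have e0 : 0 < e by [].
  by rewrite /u lt_eqF// ltrBlDr ltrDl mulr_gt0.
have mr : \forall e \near (0 : R)^'+, -1 < m (r e) < 1.
  apply: (geodesic_eventually_interior W0 cr) => //.
  near=> e; have e0 : 0 < e by [].
  have e1 : e < 1 - t by near: e; apply: nbhs_right_lt; lra.
  rewrite /r /s /u gt_eqF// -subr_gt0.
  have -> : (1 - t) * e + t * (1 - e * e) - t = e * (1 - t - t * e) by ring.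
  by rewrite mulr_gt0//; nra.
pose RHS (e : R) := (1 - t) * entropy beta (m (s e)) + t * entropy beta (m (u e))
    - kappa0 / 2 * t * (1 - t) * (((u e - s e) * c) * ((u e - s e) * c)).
have lim : RHS e @[e --> (0 : R)^'+] --> (1 - t) * entropy beta (m 0) + t * entropy beta (m 1)
    - kappa0 / 2 * t * (1 - t) * c ^+ 2.
  have cc : (u e - s e) * c @[e --> (0 : R)^'+] --> c.
    suff : (u e - s e) * c @[e --> (0 : R)^'+] --> (1 - 0) * c by rewrite subr0 mul1r.
    by apply: cvgM; [exact: cvgB|exact: cvg_cst].
  apply: cvgB.
    apply: cvgD; apply: cvgM; try exact: cvg_cst.
      exact: (geodesic_entropy_cvg Wc).
    exact: (geodesic_entropy_cvg Wc).
  by apply: cvgM; [exact: cvg_cst | rewrite expr2; exact: cvgM].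
apply: (ler_cvg_to (geodesic_entropy_cvg Wc t01 cr r01) lim).
near=> e; rewrite /RHS -expr2.
have e0 : 0 < e by [].
have e1 : e < 1 / 2 by near: e; apply: nbhs_right_lt; lra.
apply: (geodesic_convex_interior Wc c0 t01).
- exact: ltW.
- by rewrite /s /u; nra.
- have : 0 <= u e <= 1 by near: e.
  by case/andP.
- by near: e.
- by near: e.
- by near: e.
Unshelve. all: by end_near. Qed.

End geodesic.
Lemma curie_weiss_Ric_ge : Ric_ge T kappa0.
Proof.
move=> mu geo t; rewrite in_itv /= => t01.
have Wf := geodesic_W_fin geo; have W0 := W_dist_ge0 (mu 0) (mu 1).
have fE s : 0 <= s <= 1 -> free_energy T (mu s) = entropy beta (magnetization (mu s)).
  move=> s01; rewrite -{1}(state_magnetization (geo.1 s _)) ?in_itv//.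
  exact: free_energy_state.
rewrite !fE ?lexx ?ler01//.
have [c Wc] : exists c, W_dist T (mu 0) (mu 1) = c%:E.
  by exists (fine (W_dist T (mu 0) (mu 1))); rewrite fineK.
rewrite Wc lee_fin in W0.
rewrite Wc /= -EFinD lee_fin -expr2.
exact: (geodesic_convex geo Wc W0 t01).
Qed.

Lemma exists_symmetric_geodesic (e : R) : 0 < e < 1 -> exists (mu : R -> 'rV[R]_2) (c : R),
  [/\ geodesic T mu, mu 0 = state (- e), mu 1 = state e,
      W_dist T (mu 0) (mu 1) = c%:E & -1 < magnetization (mu (1 / 2)) < 1].
Proof.
move=> e01; have /andP[e0 e1] := e01.
have h1 : -1 < e < 1 by apply/andP; split; lra.
have h2 : -1 < - e < 1 by apply/andP; split; lra.
have [z [w [S [z01 wS xz yz _]]]] := exists_arclength_around h2 h1 h1.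
have [gam [g0 g1 gz Sg _]] := exists_geodesic z01 wS xz yz.
exists (fun t => state (gam t)), `|S e - S (- e)|; split; rewrite ?g0 ?g1//.
- have wk x : -z < x < z -> -1 < x < 1.
    by move: z01 => /andP[? ?] /andP[? ?]; apply/andP; split; lra.
  split=> [t|s t]; rewrite !in_itv /=.
    by move=> /gz/wk/andP[? ?]; apply: is_prob_state; rewrite !ltW.
  move=> s01 t01; rewrite g0 g1.
  rewrite (W_dist_arclength beta_ge0 beta_le1 z01 wS (gz _ s01) (gz _ t01)).
  rewrite (W_dist_arclength beta_ge0 beta_le1 z01 wS xz yz) -EFinM -normrM; congr (_%:E).
  by rewrite !Sg// distrC; congr (`|_|); ring.
- by rewrite (W_dist_arclength beta_ge0 beta_le1 z01 wS xz yz).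
have /gz : 0 <= (1 / 2 : R) <= 1 by apply/andP; split; lra.
rewrite magnetization_state; move: z01 => /andP[? ?] /andP[? ?]; apply/andP; split; lra.
Qed.

Lemma entropy_min m : -1 < m < 1 -> entropy beta 0 <= entropy beta m.
Proof.
have pos x : 0 <= x < 1 -> entropy beta 0 <= entropy beta x.
  move=> /andP[x0 x1].
  apply: (@nondecreasing_is_derive _ _ (entropy1 beta)) => //.
  - by move=> t /andP[? ?]; apply: is_derive_entropy; apply/andP; split; lra.
  - move=> t /andP[? ?]; apply: is_derive_continuous (is_derive_entropy beta _).
    by apply/andP; split; lra.
  - by move=> t /andP[? ?]; rewrite ltW// entropy1_gt0//; apply/andP; split; lra.
move=> /andP[? ?]; have [m0|m0] := leP 0 m; first by apply: pos; rewrite m0.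
by rewrite -(entropyN beta m); apply: pos; apply/andP; split; lra.
Qed.

(** On [0, e] the second derivative is largest at e. *)
Lemma entropy_le_quadratic (e : R) : 0 < e < 1 ->
  entropy beta e <= entropy beta 0 + ((1 - e ^+ 2)^-1 - beta) / 2 * e ^+ 2.
Proof.
move=> /andP[e0 e1]; set C := (1 - e ^+ 2)^-1 - beta.
have itv t : 0 <= t <= e -> -1 < t < 1 by move=> /andP[? ?]; apply/andP; split; lra.
have E1 t : 0 <= t <= e -> entropy1 beta t <= C * t.
  move=> /andP[t0 te]; rewrite -subr_ge0.
  have {1}-> : 0 = C * 0 - entropy1 beta 0 by rewrite entropy10 mulr0 subr0.
  apply: (@nondecreasing_is_derive _ (fun t => C * t - entropy1 beta t)
    (fun t => C - entropy2 beta t)) => //.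
  - move=> y /andP[? ?]; have d : is_derive y 1 (entropy1 beta) (entropy2 beta y).
      by apply: is_derive_entropy1; apply/andP; split; lra.
    by apply: is_derive_eq; rewrite /GRing.scale /=; ring.
  - move=> y /andP[? ?]; apply: continuousB.
      by apply: continuousM; [exact: cst_continuous|exact: cvg_id].
    by apply: is_derive_continuous (is_derive_entropy1 beta _); apply/andP; split; lra.
  - move=> y /andP[y0 yt]; rewrite subr_ge0 lerD2r.
    have ye : y ^+ 2 <= e ^+ 2 by rewrite lerXn2r ?nnegrE//; lra.
    have e20 : 0 < 1 - e ^+ 2 by apply: onem_sqr_gt0; apply/andP; split; lra.
    by rewrite lef_pV2 ?posrE//; lra.
pose G t := C / 2 * (t * t) - entropy beta t.
suff : G 0 <= G e by rewrite /G expr2; lra.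
apply: (@nondecreasing_is_derive _ G (fun t => C * t - entropy1 beta t) 0 e (ltW e0)).
- move=> y /andP[? ?]; have d : is_derive y 1 (entropy beta) (entropy1 beta y).
    by apply: is_derive_entropy; apply/andP; split; lra.
  by apply: is_derive_eq; rewrite /GRing.scale /=; field.
- move=> y y0e; apply: continuousB; last first.
    exact: is_derive_continuous (is_derive_entropy beta (itv _ y0e)).
  apply: continuousM; first exact: cst_continuous.
  by apply: continuousM; exact: cvg_id.
- by move=> y /andP[? ?]; rewrite subr_ge0 E1//; apply/andP; split; lra.
Qed.

(** Convexity is tested at the midpoint of the geodesic from -e to e.  The free
    energy is minimal at 0 and grows at most like C e^2 / 2, with C its second
    derivative at e, while W^2 is at least 2 e^2. *)
Lemma Ric_le_of_small (kappa e : R) : 0 < kappa -> 0 < e < 1 -> Ric_ge T kappa ->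
  kappa <= 2 * ((1 - e ^+ 2)^-1 - beta).
Proof.
move=> k0 e01 ric; have /andP[e0 e1] := e01.
have [mu [c [geo mu0 mu1 Wc mhalf]]] := exists_symmetric_geodesic e01.
have c0 : 0 <= c by have := W_dist_ge0 (mu 0) (mu 1); rewrite Wc lee_fin.
have c2 : 2 * e ^+ 2 <= c ^+ 2.
  have := W_dist_Lipschitz beta_ge0 beta_le1 (mu 0) (mu 1).
  rewrite Wc lee_fin mu0 mu1 !magnetization_state opprK ger0_norm; last by lra.
  set k := Num.sqrt _ => h.
  have k00 : 0 <= k by exact: sqrtr_ge0.
  have kk : k ^+ 2 = 1 / 2 by rewrite sqr_sqrtr//; lra.
  have := lerXn2r 2 _ _ h; rewrite !nnegrE mulr_ge0//; last by lra.
  by move=> /(_ isT c0); rewrite exprMn kk; nra.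
have half : (1 / 2 : R) \in `[0, 1] by rewrite in_itv /=; apply/andP; split; lra.
have := ric mu geo _ half; rewrite Wc /= -EFinD lee_fin -expr2.
have -> : free_energy T (mu (1 / 2)) = entropy beta (magnetization (mu (1 / 2))).
  by rewrite -{1}(state_magnetization (geo.1 _ half)) free_energy_state.
rewrite mu0 mu1 !free_energy_state entropyN.
have h1 := entropy_min mhalf; have h2 := entropy_le_quadratic e01.
set C := _ - beta in h2 *.
move=> h3.
have h4 : kappa / 8 * c ^+ 2 <= C / 2 * e ^+ 2 by lra.
have h5 : kappa / 8 * (2 * e ^+ 2) <= kappa / 8 * c ^+ 2 by rewrite ler_wpM2l//; lra.
have e20 : 0 < e ^+ 2 by rewrite exprn_gt0.
have h6 : kappa / 4 * e ^+ 2 <= C / 2 * e ^+ 2 by lra.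
rewrite ler_pM2r// in h6; lra.
Qed.

Lemma curie_weiss_Ric_le (kappa : R) : Ric_ge T kappa -> kappa <= kappa0.
Proof.
move=> ric; have [k0|k0] := leP kappa 0.
  by apply: le_trans k0 _; rewrite mulr_ge0// subr_ge0.
rewrite leNgt; apply/negP => hk.
pose d := kappa / 2 + beta.
have d1 : 1 < d by rewrite /d; lra.
pose e := (d - 1) / (2 * d).
have d0 : 0 < d by lra.
have de : d * e = (d - 1) / 2 by rewrite /e; field; rewrite gt_eqF.
have e0 : 0 < e by rewrite divr_gt0//; lra.
have e1 : e < 1 by rewrite -(ltr_pM2l d0) de; lra.
have e01 : 0 < e < 1 by rewrite e0.
have := Ric_le_of_small k0 e01 ric.
have e20 : 0 < 1 - e ^+ 2 by apply: onem_sqr_gt0; apply/andP; split; lra.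
move=> h; have {}h : d <= (1 - e ^+ 2)^-1 by rewrite /d; lra.
have : d * (1 - e ^+ 2) <= 1 by rewrite -ler_pdivlMr// mul1r.
have : d * e ^+ 2 <= d * e by rewrite ler_wpM2l ?(ltW d0)// expr2 ler_piMl// ltW.
lra.
Qed.

End curvature.

Theorem proposition5p1 (R : realType) (beta : R)
    (beta_ge0 : 0 <= beta) (beta_le1 : beta <= 1) :
  Ric_ge (curie_weiss beta) (2 * (1 - beta)) /\
  (forall kappa : R, Ric_ge (curie_weiss beta) kappa ->
     kappa <= 2 * (1 - beta)).
Proof. by split; [exact: curie_weiss_Ric_ge|exact: curie_weiss_Ric_le]. Qed.
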